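(* Let $K$ be a centrally symmetric compact convex set in the plane $\mathbb{R}^2$, and let $\mathcal{F}_1, \mathcal{F}_2, \mathcal{F}_3$ be three non-empty finite families of translates of $K$. Suppose that $K' \cap K'' \neq \varnothing$ for every pair $(K', K'')$ such that $K' \in \mathcal{F}_i$, $K'' \in \mathcal{F}_j$ and $i \neq j$. Then there exists $m \in \{1,2,3\}$ such that $\pi(\mathcal{F}_m) \le 3$.
   Context: For a family $\mathcal{F}$ of convex sets in $\mathbb{R}^d$, the piercing number $\pi(\mathcal{F})$ is the smallest positive integer $k$ such that there is a set of $k$ points in $\mathbb{R}^d$ that intersects every element of $\mathcal{F}$. Thus $\pi(\mathcal{F}) \le 3$ means that there are three points such that every member of $\mathcal{F}$ contains at least one of them. A translate of $K$ is a set of the form $K + t = \{a + t : a \in K\}$ with $t \in \mathbb{R}^2$. A set $K$ is centrally symmetric if there is a point $c$ with $K = 2c - K$. *)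

(* Defs.v *)
From HB Require Import structures.
From mathcomp Require Import all_boot all_order all_algebra.
From mathcomp Require Import all_classical all_reals all_analysis.

Set Implicit Arguments.
Unset Strict Implicit.
Unset Printing Implicit Defensive.

Import Order.TTheory GRing.Theory Num.Theory.
Import numFieldNormedType.Exports.

Local Open Scope classical_set_scope.
Local Open Scope ring_scope.

Definition translate (V : zmodType) (K : set V) (t : V) : set V :=
  [set a + t | a in K].

Definition centrally_symmetric (V : zmodType) (K : set V) : Prop :=
  exists c : V, K = [set c *+ 2 - a | a in K].

Definition pierced_by (T : Type) (F : set (set T)) (k : nat) : Prop :=
  exists2 P : set T, (P #= `I_k)%card & forall A, F A -> A `&` P !=set0.

(* A relation rather than a nat-valued function: a family that no finite set
   pierces has no piercing number, and no default value is assigned to it. *)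
Definition is_piercing_number (T : Type) (F : set (set T)) (k : nat) : Prop :=
  [/\ (0 < k)%N, pierced_by F k &
      forall j : nat, (0 < j)%N -> pierced_by F j -> (k <= j)%N].

(* Main.v *)
Require Import Defs.
From HB Require Import structures.
From mathcomp Require Import all_boot all_order all_algebra.
From mathcomp Require Import all_classical all_reals all_analysis.
From mathcomp Require Import ring lra.

Set Implicit Arguments.
Unset Strict Implicit.
Unset Printing Implicit Defensive.

Import Order.TTheory GRing.Theory Num.Theory.
Import numFieldNormedType.Exports.

Local Open Scope classical_set_scope.
Local Open Scope ring_scope.

(* Translate the centre of [K] to 0 and call the result [B]; two translates meet iff the
   difference of their translation vectors lies in [2B]. In a direction [g] with
   [sup_B g = 1], let [alpha g] be the midpoint of the [g]-range of the union of the three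
   families of translation vectors. If this range has length [2 + 2e > 2], its two ends belong
   to the same family, and the other two families lie within [1 - e] of [alpha g].
   Inscribe in [B] an affinely regular hexagon with vertices [p], [q], [q - p] and
   opposites, and let [g1], [g2], [g3] be supporting functionals of [B] at these vertices.
   Turning [p] by half a turn changes the sign of the determinant expressing that the
   three lines [g_i = alpha g_i] concur, so for some hexagon they meet in a point, by a
   connectedness argument on the compact space of all such configurations. By
   symmetry the excess [e] is smallest for [g1], and then one family lies, relative to this
   point, in the strips [|g1| <= 1 + e], [|g2| <= 1 - e], [|g3| <= 1 - e], which are
   covered by three translates of the hexagon: either a row of three, or three
   around a common vertex. If [B] has empty interior the problem is one-dimensional. *)

(** * Covering the intersection of three strips by three hexagons *)

(* [x, y] are the coordinates of [x *: p + y *: q], so that this is the hexagon [P]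
   with vertices [p], [q], [q - p] and their opposites. *)
Definition in_hexagon (R : realFieldType) (x y : R) : Prop :=
  [/\ `|x| <= 1, `|y| <= 1 & `|x + y| <= 1].

Lemma convex_comb_gt (R : realFieldType) (m k u v : R) :
  0 <= m <= 1 -> k < u -> k < v -> k < (1 - m) * u + m * v.
Proof.
move=> /andP[m0 m1] ku kv; have [m2|m2] := leP m (1 / 2).
  have := mulr_ge0 m0 (ltW (_ : 0 < v - k)); rewrite subr_gt0 => /(_ kv).
  have : 0 <= (1 / 2 - m) * (u - k) by apply: mulr_ge0; lra.
  by lra.
have : 0 <= (m - 1 / 2) * (v - k) by apply: mulr_ge0; lra.
have : 0 <= (1 - m) * (u - k) by apply: mulr_ge0; lra.
by lra.
Qed.

(** In the sector [u, v >= 0] the conclusion describes a hexagon with a vertex at the apex. The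
    first two bounds give [|u - v| <= 1], so if one of [u], [v] exceeded 2, both would exceed 1,
    against the bound on their convex combination. *)
Lemma sector_bound (R : realFieldType) (k l m u v : R) :
  0 <= k <= 1 -> 0 <= l <= 1 -> 0 <= m <= 1 -> 0 <= u -> 0 <= v ->
  u - k * v <= 1 -> v - l * u <= 1 -> (1 - m) * u + m * v <= 1 ->
  [/\ `|u - v| <= 1, u <= 2 & v <= 2].
Proof.
move=> /andP[k0 k1] /andP[l0 l1] /andP[m0 m1] u0 v0 hu hv hm.
have kv : k * v <= v by rewrite ler_piMl.
have lu : l * u <= u by rewrite ler_piMl.
have uv : `|u - v| <= 1 by rewrite ler_norml; apply/andP; split; lra.
have /andP[uv1 uv2] : -1 <= u - v <= 1 by rewrite -ler_norml.
split=> //; rewrite leNgt; apply/negP => h.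
  have [u1 v1] : 1 < u /\ 1 < v by split; lra.
  by have := @convex_comb_gt _ m 1 u v; rewrite m0 m1 u1 v1 ltNge hm => /(_ isT isT isT).
have [u1 v1] : 1 < u /\ 1 < v by split; lra.
by have := @convex_comb_gt _ m 1 u v; rewrite m0 m1 u1 v1 ltNge hm => /(_ isT isT isT).
Qed.

Lemma row_cover (R : realFieldType) (x y : R) :
  `|y| <= 1 -> `|x| <= 2 -> `|x + y| <= 2 ->
  [\/ in_hexagon x y, in_hexagon (x - 1) y | in_hexagon (x + 1) y].
Proof.
rewrite !ler_norml => /andP[y1 y2] /andP[x1 x2] /andP[s1 s2].
have [h1|h1] := leP (`|x|) 1; last first.
  have [x0|x0] := leP 0 x.
    move: h1; rewrite ger0_norm// => h1.
    by apply: Or32; split; rewrite ler_norml; apply/andP; split; lra.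
  move: h1; rewrite ltr0_norm// => h1.
  by apply: Or33; split; rewrite ler_norml; apply/andP; split; lra.
move: h1; rewrite ler_norml => /andP[h1 h2].
have [s3|s3] := leP (x + y) 1; last first.
  by apply: Or32; split; rewrite ler_norml; apply/andP; split; lra.
have [s4|s4] := leP (-1) (x + y); last first.
  by apply: Or33; split; rewrite ler_norml; apply/andP; split; lra.
by apply: Or31; split; rewrite ler_norml; apply/andP; split; lra.
Qed.

(* In coordinates as in [in_hexagon], the three strips are those cut out by the
   functionals [g1], [g2], [g3] of a [hexagon_frame] below, with [a = g1 q], [b = g2 p],
   [c = - g3 p]. *)
Lemma strips_row_cover (R : realFieldType) (a b c e x y : R) :
  0 <= a <= 1 -> 0 <= b <= 1 -> 0 <= c <= 1 -> 0 <= e ->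
  b * c <= e * (b + c) ->
  `|x + a * y| <= 1 + e -> `|b * x + y| <= 1 - e ->
  `|(1 - c) * y - c * x| <= 1 - e ->
  [\/ in_hexagon x y, in_hexagon (x - 1) y | in_hexagon (x + 1) y].
Proof.
move=> /andP[a0 a1] /andP[b0 b1] /andP[c0 c1] e0 bc h1 h2 h3.
have e1 : e <= 1 by have := le_trans (normr_ge0 _) h2; lra.
wlog y0 : x y h1 h2 h3 / 0 <= y => [hwlog|].
  have [|yN] := leP 0 y; first exact: hwlog.
  have nN (z w : R) : z = - w -> `|z| = `|w| by move=> ->; rewrite normrN.
  have [||||||] := hwlog (- x) (- y); rewrite ?oppr_ge0 ?(ltW yN)//.
  - by rewrite (nN _ (x + a * y))//; ring.
  - by rewrite (nN _ (b * x + y))//; ring.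
  - by rewrite (nN _ ((1 - c) * y - c * x))//; ring.
  - move=> [u1 u2 u3]; apply: Or31; split.
    + by rewrite (nN _ (- x))//; ring.
    + by rewrite (nN _ (- y))//; ring.
    + by rewrite (nN _ (- x - y))//; ring.
  - move=> [u1 u2 u3]; apply: Or33; split.
    + by rewrite (nN _ (- x - 1))//; ring.
    + by rewrite (nN _ (- y))//; ring.
    + by rewrite (nN _ (- x - 1 - y))//; ring.
  - move=> [u1 u2 u3]; apply: Or32; split.
    + by rewrite (nN _ (- x + 1))//; ring.
    + by rewrite (nN _ (- y))//; ring.
    + by rewrite (nN _ (- x + 1 - y))//; ring.
move: h1 h2 h3; rewrite !ler_norml => /andP[h1 h1'] /andP[h2 h2'] /andP[h3 h3'].
(* Adding [c] times the second strip and [b] times the third eliminates [x]; the hypothesis on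
   [b * c] turns the result into [y <= 1]. *)
have y1 : y <= 1.
  have [bc0|bc0] := leP (b + c) 0.
    have b00 : b = 0 by lra.
    by move: h2'; rewrite b00 mul0r add0r; lra.
  have hy : (c + b - b * c) * y <= (1 - e) * (b + c).
    have := ler_wpM2l c0 h2'; have := ler_wpM2l b0 h3'; lra.
  have dp : 0 < c + b - b * c by nra.
  by rewrite -(ler_pM2l dp) mulr1; lra.
apply: row_cover; rewrite ler_norml; apply/andP; split; try lra.
- rewrite leNgt; apply/negP => hx; nra.
- rewrite leNgt; apply/negP => hx; nra.
- rewrite leNgt; apply/negP => hx; nra.
- rewrite leNgt; apply/negP => hx; nra.
Qed.

(** If [w <= 1 + 2 * e], the product is at most [(1 - e) * (1 + e) <= 1]. *)
Lemma mul_onem_gt1 (R : realFieldType) (e k w : R) :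
  0 <= e <= k -> k <= 1 -> 1 < (1 - k) * (w - e) -> 1 + 2 * e < w.
Proof.
move=> /andP[e0 ek] k1 h; rewrite ltNge; apply/negP => w1.
have : (1 - k) * (w - e) <= (1 - k) * (1 + e) by apply: ler_wpM2l; lra.
by nra.
Qed.

Lemma mul_onem_le (R : realFieldType) (k w : R) : 0 <= k <= 1 ->
  (1 - k) * w <= 0 \/ (1 - k) * w <= w.
Proof.
move=> /andP[k0 k1]; have [h|h] := leP w 0.
  by left; rewrite mulr_ge0_le0// subr_ge0.
by right; rewrite ler_piMl ?gerBl// ltW.
Qed.

(* The bound [1 + 2 * e] in the last strip is compensated by the smaller bounds in
   the first two. *)
Lemma wide_sector_bound (R : realFieldType) (a b c e u v : R) :
  0 <= a <= 1 -> e <= b <= 1 -> e <= c <= 1 -> 0 <= e <= 1 / 2 ->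
  0 <= u -> 0 <= v ->
  u - (1 - c) * v <= 1 - (1 - c) * e -> v - (1 - b) * u <= 1 - (1 - b) * e ->
  (1 - a) * u + a * v <= 1 + 2 * e ->
  [/\ `|u - v| <= 1, u <= 2 & v <= 2].
Proof.
move=> a01 /andP[eb b1] /andP[ec c1] /andP[e0 e2] u0 v0 hu hv hm.
(* If [u > 2], then [hu] gives the premise here, so both [u] and [v] exceed [1 + 2 * e], against
   [hm]. *)
have uc : 1 < (1 - c) * (v - e) -> 1 + 2 * e < v.
  by apply: mul_onem_gt1; rewrite ?e0.
have vb : 1 < (1 - b) * (u - e) -> 1 + 2 * e < u.
  by apply: mul_onem_gt1; rewrite ?e0.
have both : 1 + 2 * e < u -> 1 + 2 * e < v -> False.
  by move=> u1 v1; have := convex_comb_gt a01 u1 v1; rewrite ltNge hm.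
have c01 : 0 <= c <= 1 by rewrite (le_trans e0 ec).
have b01 : 0 <= b <= 1 by rewrite (le_trans e0 eb).
have cv := mul_onem_le (v - e) c01; have bu := mul_onem_le (u - e) b01.
clear hm a01 b01 c01 eb ec b1 c1; split.
- rewrite ler_norml; apply/andP; split.
    by case: bu => bu; lra.
  by case: cv => cv; lra.
- by rewrite leNgt; apply/negP => u2; apply: both; [|apply: uc]; lra.
- by rewrite leNgt; apply/negP => v2; apply: both; [apply: vb|]; lra.
Qed.

(* The hexagons [q + P], [- p + P], [p - q + P] tile the neighbourhood of their
   common vertex 0; [e * p] moves the notch of their union at [p] out of the strips. *)
Lemma strips_triad_cover (R : realFieldType) (a b c e x y : R) :
  0 <= a <= 1 -> 0 <= b <= 1 -> 0 <= c <= 1 -> 0 <= e ->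
  e * (b + c) < b * c ->
  `|x + a * y| <= 1 + e -> `|b * x + y| <= 1 - e ->
  `|(1 - c) * y - c * x| <= 1 - e ->
  [\/ in_hexagon (x - e) (y - 1), in_hexagon (x - e + 1) y
    | in_hexagon (x - e - 1) (y + 1)].
Proof.
move=> /andP[a0 a1] /andP[b0 b1] /andP[c0 c1] e0 bc.
rewrite !ler_norml => /andP[h1 h1'] /andP[h2 h2'] /andP[h3 h3'].
have e1 : e <= 1 by lra.
(* The rays from [e *: p] in the directions [p], [q - p] and [- q] bound three sectors, one for each
   hexagon; the last two arguments of [sector_bound] are coordinates along the two rays. *)
have upper : 0 <= x - e + y -> 0 <= y -> in_hexagon (x - e) (y - 1).
  move=> s0 y0; have [] := @sector_bound _ (1 - a) c (1 - b) (x - e + y) y => //.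
  - by apply/andP; split; lra.
  - by rewrite c0.
  - by apply/andP; split; lra.
  - nra.
  - nra.
  - nra.
  clear - y0 s0; rewrite ler_norml => /andP[u1 u2] u3 u4.
  by split; rewrite ler_norml; apply/andP; split; lra.
have [x0|x0] := leP 0 (x - e).
  have [y0|y0] := leP 0 y; first by apply/Or31/upper; lra.
  have [] := @sector_bound _ b a c (- y) (x - e); rewrite ?a0 ?b0 ?c0//.
  - lra.
  - nra.
  - nra.
  - nra.
  clear - y0 x0; rewrite ler_norml => /andP[u1 u2] u3 u4.
  by apply: Or33; split; rewrite ler_norml; apply/andP; split; lra.
have [s0|s0] := leP 0 (x - e + y); first by apply/Or31/upper; lra.
(* Here the shift by [e *: p] works against the strip of [g1], which leaves only the bound
   [1 + 2 * e]. By hypothesis [e] is less than [b * c / (b + c)], hence less than [b] and [c] and at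
   most 1/2. *)
have [] := @wide_sector_bound _ a b c e (e - x) (e - x - y).
- by rewrite a0.
- by apply/andP; split=> //; nra.
- by apply/andP; split=> //; nra.
- have [b_gt0 c_gt0] : 0 < b /\ 0 < c by split; nra.
  have : e * (b + c) <= (b + c) / 2 by nra.
  by move=> h; apply/andP; split=> //; nra.
- by lra.
- by lra.
- by lra.
- by lra.
- by lra.
clear - x0 s0; rewrite ler_norml => /andP[u1 u2] u3 u4.
by apply: Or32; split; rewrite ler_norml; apply/andP; split; lra.
Qed.

(** * Support functionals and hexagon frames in the plane *)

Definition dot (R : pzRingType) (g x : 'rV[R]_2) : R :=
  g 0 0 * x 0 0 + g 0 1 * x 0 1.

Definition cross (R : pzRingType) (x y : 'rV[R]_2) : R :=
  x 0 0 * y 0 1 - x 0 1 * y 0 0.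

Lemma rV2P (R : pzRingType) (x y : 'rV[R]_2) :
  x 0 0 = y 0 0 -> x 0 1 = y 0 1 -> x = y.
Proof.
move=> h0 h1; apply/rowP; case=> [[|[|//]]] hi.
  by rewrite (_ : Ordinal hi = 0)//; exact: val_inj.
by rewrite (_ : Ordinal hi = 1)//; exact: val_inj.
Qed.

Lemma dotBr (R : comPzRingType) (g x y : 'rV[R]_2) : dot g (x - y) = dot g x - dot g y.
Proof. by rewrite /dot !mxE; ring. Qed.

Lemma dot_comb (R : comPzRingType) (g p q : 'rV[R]_2) (s t : R) :
  dot g (s *: p + t *: q) = s * dot g p + t * dot g q.
Proof. by rewrite /dot !mxE; ring. Qed.

Lemma dotN (R : pzRingType) (g x : 'rV[R]_2) : dot (- g) x = - dot g x.
Proof. by rewrite /dot !mxE !mulNr opprD. Qed.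

Lemma cross_decomp (R : fieldType) (p q v : 'rV[R]_2) : cross p q != 0 ->
  v = (cross v q / cross p q) *: p + (cross p v / cross p q) *: q.
Proof. by move=> h; apply: rV2P; rewrite !mxE; move: h; rewrite /cross => h; field. Qed.

Lemma dot_eq0 (R : fieldType) (p q v : 'rV[R]_2) : cross p q != 0 ->
  dot v p = 0 -> dot v q = 0 -> v = 0.
Proof.
rewrite /dot /cross => h h1 h2; apply: rV2P; rewrite !mxE; apply/eqP.
  rewrite -(mulIr_eq0 _ (mulIf h)); apply/eqP.
  transitivity ((v 0 0 * p 0 0 + v 0 1 * p 0 1) * q 0 1
    - (v 0 0 * q 0 0 + v 0 1 * q 0 1) * p 0 1); first by ring.
  by rewrite h1 h2; ring.
rewrite -(mulIr_eq0 _ (mulIf h)); apply/eqP.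
transitivity ((v 0 0 * q 0 0 + v 0 1 * q 0 1) * p 0 0
  - (v 0 0 * p 0 0 + v 0 1 * p 0 1) * q 0 0); first by ring.
by rewrite h1 h2; ring.
Qed.

Definition abs_convex (R : realType) (B : set 'rV[R]_2) : Prop :=
  forall x y s t, B x -> B y -> `|s| + `|t| <= 1 -> B (s *: x + t *: y).

Definition polar (R : realType) (B : set 'rV[R]_2) : set 'rV[R]_2 :=
  [set g | forall b, B b -> dot g b <= 1].

Lemma abs_convexZ (R : realType) (B : set 'rV[R]_2) x s :
  abs_convex B -> B x -> `|s| <= 1 -> B (s *: x).
Proof.
move=> cB Bx s1; rewrite -[s *: x]addr0 -(scale0r x); apply: cB => //.
by rewrite normr0 addr0.
Qed.

Lemma abs_convexN (R : realType) (B : set 'rV[R]_2) x :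
  abs_convex B -> B x -> B (- x).
Proof. by move=> cB Bx; rewrite -scaleN1r; apply: abs_convexZ; rewrite ?normrN1. Qed.

Lemma polar_norm (R : realType) (B : set 'rV[R]_2) g x :
  abs_convex B -> polar B g -> B x -> `|dot g x| <= 1.
Proof.
move=> cB Bg Bx; rewrite ler_norml Bg// andbT lerNl.
have := Bg _ (abs_convexN cB Bx); rewrite /dot !mxE; lra.
Qed.

Lemma polarN (R : realType) (B : set 'rV[R]_2) g :
  abs_convex B -> polar B g -> polar B (- g).
Proof.
move=> cB Bg b Bb; have := Bg _ (abs_convexN cB Bb).
by rewrite /dot !mxE; lra.
Qed.

(** Every condition is closed when [B] is, as [compact_frame_space] needs; the independence of [p]
    and [q] is derived in [hexagon_frame_cross]. *)
Record hexagon_frame (R : realType) (B : set 'rV[R]_2)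
    (p q g1 g2 g3 : 'rV[R]_2) : Prop := HexagonFrame {
  frame_p : B p; frame_q : B q; frame_r : B (q - p);
  frame_g1 : polar B g1; frame_g2 : polar B g2; frame_g3 : polar B g3;
  frame_dot1 : dot g1 p = 1; frame_dot2 : dot g2 q = 1;
  frame_dot3 : dot g3 (q - p) = 1 }.

(** One step around the hexagon; it lets any of the three functionals come first. *)
Lemma hexagon_frame_rot (R : realType) (B : set 'rV[R]_2) p q g1 g2 g3 :
  abs_convex B -> hexagon_frame B p q g1 g2 g3 ->
  hexagon_frame B q (q - p) g2 g3 (- g1).
Proof.
move=> cB [? ? ? ? ? ? h1 ? ?]; split=> //.
- by rewrite addrC addrA addNr add0r; exact: abs_convexN.
- exact: polarN.
- by rewrite -h1 /dot !mxE; ring.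
Qed.

(** Each vertex is the sum of its two neighbours, so its functional takes there two values with sum
    1, both at most 1. *)
Lemma hexagon_frame_coef (R : realType) (B : set 'rV[R]_2) p q g1 g2 g3 :
  abs_convex B -> hexagon_frame B p q g1 g2 g3 ->
  [/\ 0 <= dot g1 q <= 1, 0 <= dot g2 p <= 1 & 0 <= - dot g3 p <= 1].
Proof.
move=> cB [Bp Bq Br P1 P2 P3 h1 h2 h3].
have := polar_norm cB P1 Br; have := polar_norm cB P1 Bq.
have := polar_norm cB P2 Br; have := polar_norm cB P2 Bp.
have := polar_norm cB P3 Bq; have := polar_norm cB P3 Bp.
move: h3; rewrite !dotBr !ler_norml h1 h2 => h3.
move=> /andP[? ?] /andP[? ?] /andP[? ?] /andP[? ?] /andP[? ?] /andP[? ?].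
by split; apply/andP; split; lra.
Qed.

(** If [p] and [q] were dependent, [q] would be [dot g1 q *: p]; then [dot g2 q = 1] forces the
    factor to be 1, and [q - p = 0] contradicts [dot g3 (q - p) = 1]. *)
Lemma hexagon_frame_cross (R : realType) (B : set 'rV[R]_2) p q g1 g2 g3 :
  abs_convex B -> hexagon_frame B p q g1 g2 g3 -> cross p q != 0.
Proof.
move=> cB H; have [] := hexagon_frame_coef cB H.
move: H => [Bp Bq Br P1 P2 P3 h1 h2 h3].
move=> /andP[a0 a1] /andP[b0 b1] /andP[c0 c1]; apply/eqP => d0.
have h4 : dot g1 q *: p = q.
  apply: rV2P; rewrite !mxE; apply/eqP; rewrite -subr_eq0.
    rewrite -[X in _ - X]mul1r -h1 -(mulr0 (g1 0 1)) -d0 /dot /cross.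
    by apply/eqP; ring.
  rewrite -[X in _ - X]mul1r -h1 -(mulr0 (- g1 0 0)) -d0 /dot /cross.
  by apply/eqP; ring.
have h5 : dot g1 q * dot g2 p = 1.
  by rewrite -h2 -[in RHS]h4 /dot !mxE; ring.
have h6 : dot g1 q = 1 by nra.
move: h3; rewrite -h4 h6 scale1r subrr /dot !mxE; lra.
Qed.

(** If [|x| + |y| > 1], then [x] and [y] have opposite signs, and the point is rewritten over
    [q - p] and the one of [p], [q] that bounds its sector up to sign. *)
Lemma hexagon_sub (R : realType) (B : set 'rV[R]_2) p q x y :
  abs_convex B -> B p -> B q -> B (q - p) -> in_hexagon x y ->
  B (x *: p + y *: q).
Proof.
move=> cB Bp Bq Br [x1 y1 s1].
have [xy|xy] := leP (`|x| + `|y|) 1; first exact: cB.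
have e1 : x *: p + y *: q = (- x) *: (q - p) + (x + y) *: q.
  by apply: rV2P; rewrite !mxE; ring.
have e2 : x *: p + y *: q = y *: (q - p) + (x + y) *: p.
  by apply: rV2P; rewrite !mxE; ring.
move: x1 y1 s1 xy; rewrite !ler_norml => /andP[? ?] /andP[? ?] /andP[? ?] xy.
have [x0|x0] := leP 0 x; have [y0|y0] := leP 0 y; move: xy.
- by rewrite !ger0_norm//; lra.
- rewrite ger0_norm// ltr0_norm// => xy.
  have [s0|s0] := leP 0 (x + y).
    rewrite e2; apply: cB => //.
    by rewrite ltr0_norm// ger0_norm//; lra.
  rewrite e1; apply: cB => //.
  by rewrite normrN ger0_norm// ltr0_norm//; lra.
- rewrite ltr0_norm// ger0_norm// => xy.
  have [s0|s0] := leP 0 (x + y).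
    rewrite e1; apply: cB => //.
    by rewrite normrN ltr0_norm// ger0_norm//; lra.
  rewrite e2; apply: cB => //.
  by rewrite ger0_norm// ltr0_norm//; lra.
- by rewrite !ltr0_norm//; lra.
Qed.

Lemma hexagon_frame_cover (R : realType) (B : set 'rV[R]_2) p q g1 g2 g3 (e : R) :
  abs_convex B -> hexagon_frame B p q g1 g2 g3 -> 0 <= e ->
  exists z1 z2 z3, forall v, `|dot g1 v| <= 1 + e -> `|dot g2 v| <= 1 - e ->
    `|dot g3 v| <= 1 - e -> [\/ B (v - z1), B (v - z2) | B (v - z3)].
Proof.
move=> cB H e0; have [a01 b01 c01] := hexagon_frame_coef cB H.
have d0 := hexagon_frame_cross cB H.
move: H => [Bp Bq Br P1 P2 P3 h1 h2 h3].
have h3' : dot g3 q = 1 + dot g3 p by rewrite -h3 /dot !mxE; ring.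
have sub x y x' y' : in_hexagon (x - x') (y - y') ->
    B (x *: p + y *: q - (x' *: p + y' *: q)).
  move=> h; rewrite (_ : _ - _ = (x - x') *: p + (y - y') *: q).
    exact: hexagon_sub.
  by apply: rV2P; rewrite !mxE; ring.
have [bc|bc] := leP (dot g2 p * - dot g3 p) (e * (dot g2 p + - dot g3 p)).
  exists (0 *: p + 0 *: q), (1 *: p + 0 *: q), ((-1) *: p + 0 *: q) => v.
  rewrite (cross_decomp v d0); move: (cross v q / _) (cross p v / _) => x y.
  rewrite !dot_comb h1 h2 h3' => k1 k2 k3.
  have := @strips_row_cover _ _ _ _ e x y a01 b01 c01 e0 bc.
  case.
  - by rewrite (_ : x + _ = x * 1 + y * dot g1 q)//; ring.
  - by rewrite (_ : dot g2 p * x + y = x * dot g2 p + y * 1)//; ring.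
  - by rewrite (_ : _ * y - _ * x = x * dot g3 p + y * (1 + dot g3 p))//; ring.
  - by move=> h; apply: Or31; apply: (sub x y 0 0); rewrite !subr0.
  - by move=> h; apply: Or32; apply: (sub x y 1 0); rewrite !subr0.
  - by move=> h; apply: Or33; apply: (sub x y (-1) 0); rewrite !subr0 opprK.
exists (e *: p + 1 *: q), ((e - 1) *: p + 0 *: q), ((e + 1) *: p + (-1) *: q) => v.
rewrite (cross_decomp v d0); move: (cross v q / _) (cross p v / _) => x y.
rewrite !dot_comb h1 h2 h3' => k1 k2 k3.
have := @strips_triad_cover _ _ _ _ e x y a01 b01 c01 e0 bc.
case.
- by rewrite (_ : x + _ = x * 1 + y * dot g1 q)//; ring.
- by rewrite (_ : dot g2 p * x + y = x * dot g2 p + y * 1)//; ring.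
- by rewrite (_ : _ * y - _ * x = x * dot g3 p + y * (1 + dot g3 p))//; ring.
- by move=> h; apply: Or31; exact: (sub x y e 1).
- move=> h; apply: Or32; apply: (sub x y (e - 1) 0).
  by rewrite (subr0 y); have -> : x - (e - 1) = x - e + 1 by ring.
- move=> h; apply: Or33; have k := sub x y (e + 1) (-1); apply: k.
  by have [-> ->] : x - (e + 1) = x - e - 1 /\ y - -1 = y + 1 by split; ring.
Qed.

Lemma continuous_dot (R : realType) (T : topologicalType) (f h : T -> 'rV[R]_2) :
  continuous f -> continuous h -> continuous (fun x => dot (f x) (h x)).
Proof.
move=> cf ch x.
have cc (k : T -> 'rV[R]_2) i : continuous k -> (fun y => k y 0 i) @ x --> k x 0 i.
  by move=> ck; exact: (continuous_comp (ck x) (@coord_continuous R 1 2 0 i (k x))).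
exact: (cvgD (cvgM (cc f 0 cf) (cc h 0 ch)) (cvgM (cc f 1 cf) (cc h 1 ch))).
Qed.

Lemma continuous_cross (R : realType) (T : topologicalType) (f h : T -> 'rV[R]_2) :
  continuous f -> continuous h -> continuous (fun x => cross (f x) (h x)).
Proof.
move=> cf ch x.
have cc (k : T -> 'rV[R]_2) i : continuous k -> (fun y => k y 0 i) @ x --> k x 0 i.
  by move=> ck; exact: (continuous_comp (ck x) (@coord_continuous R 1 2 0 i (k x))).
exact: (cvgB (cvgM (cc f 0 cf) (cc h 1 ch)) (cvgM (cc f 1 cf) (cc h 0 ch))).
Qed.

Lemma dot_continuous (R : realType) (g : 'rV[R]_2) : continuous (dot g).
Proof.
have ci : continuous (id : 'rV[R]_2 -> _) by move=> x; exact: cvg_id.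
exact: (continuous_dot (@cst_continuous _ _ g) ci).
Qed.

Lemma cross_continuous (R : realType) (p : 'rV[R]_2) : continuous (cross p).
Proof.
have ci : continuous (id : 'rV[R]_2 -> _) by move=> x; exact: cvg_id.
exact: (continuous_cross (@cst_continuous _ _ p) ci).
Qed.

(** * Existence of hexagon frames *)

Lemma dot_gt0 (R : realType) (p : 'rV[R]_2) : p != 0 -> 0 < dot p p.
Proof.
move=> p0; rewrite lt_neqAle addr_ge0 ?sqr_ge0// andbT eq_sym.
apply: contra p0; rewrite /dot paddr_eq0 ?sqr_ge0// !mulf_eq0 !orbb.
by move=> /andP[/eqP ? /eqP ?]; apply/eqP/rV2P; rewrite !mxE.
Qed.

Lemma cross_eq0_scale (R : realType) (w z : 'rV[R]_2) :
  w != 0 -> cross w z = 0 -> z = (dot w z / dot w w) *: w.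
Proof.
move=> /dot_gt0/lt0r_neq0 N0 wz; apply: rV2P; rewrite !mxE; apply/eqP; rewrite -subr_eq0.
  have -> : 0 = (- w 0 1 / dot w w) * cross w z by rewrite wz mulr0.
  by apply/eqP; move: N0; rewrite /dot /cross => N0; field.
have -> : 0 = (w 0 0 / dot w w) * cross w z by rewrite wz mulr0.
by apply/eqP; move: N0; rewrite /dot /cross => N0; field.
Qed.

(** Hahn-Banach by hand: in coordinates [x] along [p] and [y] along its quarter turn [J], the
    functional is [x + c * y], where [c] lies between the slopes imposed by the points with [y < 0]
    and those with [y > 0]. These slopes are compatible because a segment joining two such points
    crosses the line of [p] inside [B], at a multiple of [p] with factor at most 1. *)
Lemma support_functional (R : realType) (B : set 'rV[R]_2) p :
  abs_convex B -> B p -> p != 0 -> (forall s, 1 < s -> ~ B (s *: p)) ->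
  (exists2 b, B b & cross p b != 0) -> exists2 g, polar B g & dot g p = 1.
Proof.
move=> cB Bp p0 pmax [b0 Bb0 pb0].
have N0 := dot_gt0 p0; set N := dot p p in N0.
pose x b := dot p b / N; pose y b := cross p b / N.
pose J : 'rV[R]_2 := \row_j if j == 0 then - p 0 1 else p 0 0.
have xyE b : b = x b *: p + y b *: J.
  by apply: rV2P; rewrite /x /y /N /J /cross /dot !mxE /=; field; exact: lt0r_neq0.
have yN b : y (- b) = - y b by rewrite /y /cross !mxE; field; exact: lt0r_neq0.
have [c [cneg cpos]] : exists c, (forall b, B b -> y b < 0 -> x b + c * y b <= 1) /\
    (forall b, B b -> 0 < y b -> x b + c * y b <= 1).
  pose S := [set (x b - 1) / (- y b) | b in [set b | B b /\ y b < 0]].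
  have ubS b : B b -> 0 < y b -> ubound S ((1 - x b) / y b).
    move=> Bb yb _ [b' [Bb' yb'] <-].
    pose k := (y b + - y b'); have k0 : 0 < k by rewrite /k; lra.
    rewrite ler_pdivrMr ?oppr_gt0// mulrAC ler_pdivlMr//.
    have Bc : B ((- y b' / k) *: b + (y b / k) *: b').
      apply: cB => //; rewrite !ger0_norm; last 2 first.
      - by apply: divr_ge0; lra.
      - by apply: divr_ge0; lra.
      by rewrite -mulrDl addrC divff// lt0r_neq0.
    have ce : (- y b' / k) *: b + (y b / k) *: b' =
        ((- y b' * x b + y b * x b') / k) *: p.
      transitivity ((- y b' / k) *: (x b *: p + y b *: J)
          + (y b / k) *: (x b' *: p + y b' *: J)); first by rewrite -!xyE.
      by apply: rV2P; rewrite /J !mxE /=; field; exact: lt0r_neq0.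
    have : (- y b' * x b + y b * x b') / k <= 1.
      rewrite leNgt; apply/negP => /pmax; apply; rewrite -ce; exact: Bc.
    by rewrite ler_pdivrMr// /k; lra.
  wlog yb0 : b0 Bb0 pb0 / 0 < y b0.
    move=> h; have [yb|yb] := ltP 0 (y b0); first exact: h yb.
    apply: (h (- b0)) => //.
    - exact: abs_convexN.
    - rewrite (_ : cross p (- b0) = - cross p b0) ?oppr_eq0//.
      by rewrite /cross !mxE; ring.
    - rewrite yN oppr_gt0 lt_neqAle yb andbT /y mulf_neq0// invr_neq0//.
      exact: lt0r_neq0.
  have S0 : S !=set0.
    exists ((x (- b0) - 1) / - y (- b0)), (- b0) => //; split; first exact: abs_convexN.
    by rewrite yN oppr_lt0.
  have supS : has_sup S by split=> //; exists ((1 - x b0) / y b0); exact: ubS.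
  exists (sup S); split=> b Bb yb.
    have : (x b - 1) / (- y b) <= sup S.
      by apply: ub_le_sup; [case: supS|exists b].
    by rewrite ler_pdivrMr ?oppr_gt0//; lra.
  have : sup S <= (1 - x b) / y b by apply: ge_sup => //; exact: ubS.
  by rewrite ler_pdivlMr//; lra.
exists (N^-1 *: (p + c *: J)); last first.
  rewrite /dot /J !mxE /=; move: N0; rewrite /N /dot => /lt0r_neq0 N0; field.
  exact: N0.
move=> b Bb; rewrite (_ : dot _ _ = x b + c * y b); last first.
  by rewrite /x /y /J /dot /cross !mxE /=; field; exact: lt0r_neq0.
have [yb|yb|yb] := ltgtP (y b) 0; [exact: cneg|exact: cpos|].
rewrite yb mulr0 addr0 leNgt; apply/negP => /pmax; apply.
by rewrite -[x b *: p]addr0 -(scale0r J) -yb -xyE.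
Qed.

Lemma boundary_point (R : realType) (B : set 'rV[R]_2) b1 b2 w :
  compact B -> abs_convex B -> B b1 -> B b2 -> cross b1 b2 != 0 -> w != 0 ->
  exists p, [/\ B p, cross w p = 0, 0 < dot w p & forall s, 1 < s -> ~ B (s *: p)].
Proof.
move=> kB cB Bb1 Bb2 b12 w0.
have B0 : B 0 by rewrite -(scale0r b1); apply: abs_convexZ; rewrite ?normr0.
have cl : closed [set b | cross w b = 0].
  exact: ((continuous_closedP _).1 (@cross_continuous _ w) _ (@closed_eq _ 0)).
have [p [Bp wp] pmax] : exists2 p, (B `&` [set b | cross w b = 0]) p &
    forall b, (B `&` [set b | cross w b = 0]) b -> dot w b <= dot w p.
  have [|||p /set_mem Ap pmax] := @compact_EVT_max _ R (dot w) (B `&` [set b | cross w b = 0]).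
  - by exists 0; split=> //=; rewrite /cross !mxE; ring.
  - exact: compact_closedI.
  - exact/continuous_subspaceT/dot_continuous.
  - by exists p => // b Ab; apply: pmax; rewrite inE.
have wE := cross_decomp w b12.
(* [k] is the sum of the absolute coordinates of [w] over [b1], [b2], so [k^-1 *: w] lies in [B] and
   the maximum of [dot w] is positive. *)
pose k := `|cross w b2 / cross b1 b2| + `|cross b1 w / cross b1 b2|.
have k0 : 0 < k.
  rewrite lt_neqAle addr_ge0 ?normr_ge0// andbT eq_sym.
  apply: contra w0; rewrite /k paddr_eq0 ?normr_ge0// !normr_eq0.
  by move=> /andP[/eqP h1 /eqP h2]; rewrite wE h1 h2 !scale0r addr0.
have Bw : B (k^-1 *: w).
  rewrite wE scalerDr !scalerA; apply: cB => //.
  by rewrite !(normrM k^-1) -mulrDr gtr0_norm ?invr_gt0// mulVf// lt0r_neq0.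
have wp0 : 0 < dot w p.
  apply: (lt_le_trans (_ : 0 < dot w (k^-1 *: w))); last first.
    by apply: pmax; split=> //=; rewrite /cross !mxE; ring.
  rewrite (_ : dot _ _ = k^-1 * dot w w) ?mulr_gt0 ?invr_gt0 ?dot_gt0//.
  by rewrite /dot !mxE; ring.
exists p; split=> // s s1 Bsp.
have : dot w (s *: p) <= dot w p.
  apply: pmax; split=> //=; transitivity (s * cross w p); last by rewrite wp mulr0.
  by rewrite /cross !mxE; ring.
rewrite (_ : dot w (s *: p) = s * dot w p); last by rewrite /dot !mxE; ring.
by rewrite ger_pMl// leNgt s1.
Qed.

(* Among the [q] with both [q] and [q - p] in [B], one with [cross p q] maximal has
   [q] and [q - p] on the boundary. *)
Lemma hexagon_vertex (R : realType) (B : set 'rV[R]_2) b1 b2 p :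
  compact B -> abs_convex B -> B b1 -> B b2 -> cross b1 b2 != 0 ->
  B p -> p != 0 ->
  exists q, [/\ B q, B (q - p), 0 < cross p q, forall s, 1 < s -> ~ B (s *: q)
    & forall s, 1 < s -> ~ B (s *: (q - p))].
Proof.
move=> kB cB Bb1 Bb2 b12 Bp p0.
have [z [Bz pz]] : exists z, B z /\ 0 < cross p z.
  have [z [Bz pz]] : exists z, B z /\ cross p z != 0.
    have [h1|h1] := eqVneq (cross p b1) 0; last by exists b1.
    have [h2|h2] := eqVneq (cross p b2) 0; last by exists b2.
    case/eqP: p0; rewrite (cross_decomp p b12).
    have -> : cross b1 p = 0 by move: h1; rewrite /cross; lra.
    by rewrite h2 !mul0r !scale0r addr0.
  have [h|h] := ltP 0 (cross p z); first by exists z.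
  exists (- z); split; first exact: abs_convexN.
  rewrite (_ : cross _ _ = - cross p z); last by rewrite /cross !mxE; ring.
  by rewrite oppr_gt0 lt_neqAle pz.
pose A := B `&` [set q | B (q - p)].
have Am : A (2^-1 *: p + 2^-1 *: z).
  split => /=; first by apply: cB => //; rewrite !ger0_norm; lra.
  rewrite (_ : _ - p = (- 2^-1) *: p + 2^-1 *: z); last first.
    by apply: rV2P; rewrite !mxE; field.
  by apply: cB => //; rewrite normrN !ger0_norm; lra.
have [q [Bq /= Bqp] qmax] : exists2 q, A q & forall q', A q' -> cross p q' <= cross p q.
  have [|||q /set_mem Aq qmax] := @compact_EVT_max _ R (cross p) A.
  - by exists (2^-1 *: p + 2^-1 *: z).
  - apply: compact_closedI => //.
    have cont : continuous (fun q : 'rV[R]_2 => q - p).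
      by move=> q; exact: (cvgB cvg_id (cvg_cst p)).
    exact: ((continuous_closedP _).1 cont _ (compact_closed (@norm_hausdorff _ _) kB)).
  - exact/continuous_subspaceT/cross_continuous.
  - by exists q => // b Ab; apply: qmax; rewrite inE.
have pq : 0 < cross p q.
  apply: lt_le_trans (qmax _ Am).
  rewrite (_ : cross _ _ = cross p z / 2); last by rewrite /cross !mxE; field.
  by rewrite divr_gt0.
(* If [s *: q] or [s *: (q - p)] were in [B] for some [s > 1], a small move of [q] would stay in [A]
   and multiply [cross p q] by [1 + eta * (s - 1)]; this [eta] makes the absolute coefficients sum
   to 1. *)
have step (s : R) : 1 < s -> exists eta, [/\ 0 < eta, eta < 1 & s^-1 + eta + eta = 1].
  move=> s1; exists ((1 - s^-1) / 2).
  have s0 : 0 < s by lra.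
  have h0 : 0 < s^-1 by rewrite invr_gt0.
  have h1 : s^-1 < 1 by rewrite invf_lt1.
  by split; lra.
exists q; split=> // s s1 Bs; have [eta [e0 e1 se]] := step s s1.
all: have s0 : s != 0 by apply: lt0r_neq0; lra.
all: have si : 0 < s^-1 by rewrite invr_gt0; lra.
  have Aq' : A ((s^-1 + eta) *: (s *: q) + (- eta) *: (q - p)).
    split => /=; first by apply: cB => //; rewrite normrN !ger0_norm; lra.
    rewrite (_ : _ - p = (1 - eta) *: (q - p) + eta *: (s *: q)).
      by apply: cB => //; rewrite !ger0_norm; lra.
    by apply: rV2P; rewrite !mxE; field.
  have := qmax _ Aq'.
  rewrite (_ : cross p (_ + _) = (1 + eta * (s - 1)) * cross p q); last first.
    by rewrite /cross !mxE; field.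
  by rewrite ger_pMl// gerDl leNgt mulr_gt0// subr_gt0.
have Aq' : A ((1 - eta) *: q + eta *: (s *: (q - p))).
  split => /=; first by apply: cB => //; rewrite !ger0_norm; lra.
  rewrite (_ : _ - p = (s^-1 + eta) *: (s *: (q - p)) + (- eta) *: q).
    by apply: cB => //; rewrite normrN !ger0_norm; lra.
  by apply: rV2P; rewrite !mxE; field.
have := qmax _ Aq'.
rewrite (_ : cross p (_ + _) = (1 + eta * (s - 1)) * cross p q); last first.
  by rewrite /cross !mxE; field.
by rewrite ger_pMl// gerDl leNgt mulr_gt0// subr_gt0.
Qed.

Lemma hexagon_frame_exists (R : realType) (B : set 'rV[R]_2) b1 b2 w :
  compact B -> abs_convex B -> B b1 -> B b2 -> cross b1 b2 != 0 -> w != 0 ->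
  exists p q g1 g2 g3, [/\ hexagon_frame B p q g1 g2 g3, cross w p = 0,
    0 < dot w p & 0 < cross p q].
Proof.
move=> kB cB Bb1 Bb2 b12 w0.
have [p [Bp wp wp0 pmax]] := boundary_point kB cB Bb1 Bb2 b12 w0.
have p0 : p != 0.
  by apply: contraTneq wp0 => ->; rewrite /dot !mxE !mulr0 addr0 ltxx.
have [q [Bq Br pq qmax rmax]] := hexagon_vertex kB cB Bb1 Bb2 b12 Bp p0.
have q0 : q != 0.
  by apply: contraTneq pq => ->; rewrite /cross !mxE !mulr0 subr0 ltxx.
have r0 : q - p != 0.
  by apply: contraTneq pq => /subr0_eq ->; rewrite /cross mulrC subrr ltxx.
have [|g1 G1 d1] := support_functional cB Bp p0 pmax.
  by exists q => //; exact: lt0r_neq0.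
have [|g2 G2 d2] := support_functional cB Bq q0 qmax.
  exists p => //; rewrite (_ : cross _ _ = - cross p q).
    by rewrite oppr_eq0 lt0r_neq0.
  by rewrite /cross; ring.
have [|g3 G3 d3] := support_functional cB Br r0 rmax.
  exists p => //; rewrite (_ : cross _ _ = - cross p q).
    by rewrite oppr_eq0 lt0r_neq0.
  by rewrite /cross !mxE; ring.
by exists p, q, g1, g2, g3; split.
Qed.

(** * A frame with concurrent mid-lines *)

Lemma closed_polar (R : realType) (B : set 'rV[R]_2) : closed (polar B).
Proof.
have -> : polar B = \bigcap_(b in B) [set g | dot g b <= 1].
  by apply/seteqP; split=> g h b; exact: h.
apply: closed_bigI => b _.
have cont : continuous (fun g : 'rV[R]_2 => dot g b).
  have h1 : continuous (fun g : 'rV[R]_2 => g) by move=> g; exact: cvg_id.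
  have h2 : continuous (fun g : 'rV[R]_2 => b) by exact: cst_continuous.
  exact: (continuous_dot h1 h2).
exact: ((continuous_closedP _).1 cont _ (@closed_le _ 1)).
Qed.

(* The polar lies in the image of a square under the dual basis of [b1, b2]. *)
Lemma compact_polar (R : realType) (B : set 'rV[R]_2) b1 b2 :
  abs_convex B -> B b1 -> B b2 -> cross b1 b2 != 0 -> compact (polar B).
Proof.
move=> cB Bb1 Bb2 b12.
pose e1 : 'rV[R]_2 := (cross b1 b2)^-1 *: \row_j if j == 0 then b2 0 1 else - b2 0 0.
pose e2 : 'rV[R]_2 := (cross b1 b2)^-1 *: \row_j if j == 0 then - b1 0 1 else b1 0 0.
pose f (u : R * R) := u.1 *: e1 + u.2 *: e2.
have cf : continuous f.
  move=> u; have h1 : @fst R R @ u --> u.1 by exact: cvg_fst.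
  have h2 : @snd R R @ u --> u.2 by exact: cvg_snd.
  exact: (cvgD (cvgZr_tmp (a := e1) h1) (cvgZr_tmp (a := e2) h2)).
have kI : compact (f @` (`[-1, 1]%classic `*` `[-1, 1]%classic)).
  apply: continuous_compact; first exact: continuous_subspaceT.
  by apply: compact_setX; exact: segment_compact.
apply: (subclosed_compact (@closed_polar _ B) kI) => g Pg.
exists (dot g b1, dot g b2).
  by split; rewrite /= in_itv /= -ler_norml; exact: (polar_norm cB).
rewrite /f /e1 /e2; apply: rV2P; rewrite !mxE /= /dot; move: b12;
  by rewrite /cross => b12; field.
Qed.

(** The values of [f] where [phi <= 0] and where [0 <= phi] form two closed sets covering [[a, b]],
    so by connectedness they meet. This finds both signs in one fibre without a continuous choice of
    points. *)
Lemma compact_fibre_ivt (R : realType) (T : topologicalType) (X : set T)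
    (f phi : T -> R) (a b : R) : a <= b ->
  compact X -> continuous f -> continuous phi ->
  (forall t, a <= t <= b -> exists2 x, X x & f x = t) ->
  (exists2 x, X x & f x = a /\ phi x <= 0) ->
  (exists2 x, X x & f x = b /\ 0 <= phi x) ->
  exists x y, [/\ X x, X y, f x = f y, phi x <= 0 & 0 <= phi y].
Proof.
move=> ab kX cf cphi fX [xa Xa [fa na]] [xb Xb [fb pb]].
pose N := f @` (X `&` [set x | phi x <= 0]).
pose P := f @` (X `&` [set x | 0 <= phi x]).
have clN : closed N.
  apply: compact_closed; first exact: norm_hausdorff.
  apply: continuous_compact; first exact: continuous_subspaceT.
  by apply: compact_closedI => //; exact: ((continuous_closedP _).1 cphi _ (@closed_le _ 0)).
have clP : closed P.
  apply: compact_closed; first exact: norm_hausdorff.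
  apply: continuous_compact; first exact: continuous_subspaceT.
  by apply: compact_closedI => //; exact: ((continuous_closedP _).1 cphi _ (@closed_ge _ 0)).
suff : exists t, N t /\ P t.
  by move=> [t [[x [Xx nx] <-] [y [Xy py] fyx]]]; exists x, y; split.
apply: contrapT => NP.
have disj t : N t -> ~ P t by move=> Nt Pt; apply: NP; exists t.
have Pb : P b by exists xb.
apply: (disj b) => //.
have : (`[a, b]%classic `&` N) b; last by case.
have -> : `[a, b]%classic `&` N = `[a, b]%classic.
  apply: (@segment_connected R a b).
  - by exists a; split; [rewrite /= in_itv /= lexx|exists xa].
  - exists (~` P); first exact: closed_openC.
    apply/seteqP; split=> t [tab Nt]; split=> //; first exact: disj.
    move: tab; rewrite /= in_itv /= => /fX[x Xx fx].
    have [h|h] := leP (phi x) 0; first by exists x.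
    by case: Nt; exists x => //; split=> //=; exact: ltW.
  - by exists N.
by rewrite /= in_itv /= lexx andbT.
Qed.

(** With [p] and [q] fixed, the conditions on the functionals are convex. *)
Lemma hexagon_frame_conv (R : realType) (B : set 'rV[R]_2) p q g1 g2 g3 h1 h2 h3 s :
  hexagon_frame B p q g1 g2 g3 -> hexagon_frame B p q h1 h2 h3 -> 0 <= s <= 1 ->
  hexagon_frame B p q (g1 + s *: (h1 - g1)) (g2 + s *: (h2 - g2)) (g3 + s *: (h3 - g3)).
Proof.
move=> [Bp Bq Br G1 G2 G3 g1p g2q g3r] [_ _ _ H1 H2 H3 h1p h2q h3r] /andP[s0 s1].
have dotE (g h x : 'rV[R]_2) : dot (g + s *: (h - g)) x = (1 - s) * dot g x + s * dot h x.
  by rewrite /dot !mxE; ring.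
have polE g h : polar B g -> polar B h -> polar B (g + s *: (h - g)).
  move=> G H b Bb; rewrite dotE.
  have := ler_wpM2l s0 (H _ Bb); have s1' : 0 <= 1 - s by lra.
  by have := ler_wpM2l s1' (G _ Bb); lra.
split=> //; [exact: polE|exact: polE|exact: polE| | |].
- by rewrite dotE g1p h1p; ring.
- by rewrite dotE g2q h2q; ring.
- by rewrite dotE g3r h3r; ring.
Qed.

(* The determinant of the system [dot g x = alpha g], [g = g1, g2, g3], in [x]. *)
Definition concurrency (R : realType) (alpha : 'rV[R]_2 -> R) (g1 g2 g3 : 'rV[R]_2) : R :=
  cross g2 g3 * alpha g1 - cross g1 g3 * alpha g2 + cross g1 g2 * alpha g3.

Lemma continuous_concurrency (R : realType) (T : topologicalType)
    (alpha : 'rV[R]_2 -> R) (f1 f2 f3 : T -> 'rV[R]_2) :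
  continuous alpha -> continuous f1 -> continuous f2 -> continuous f3 ->
  continuous (fun x => concurrency alpha (f1 x) (f2 x) (f3 x)).
Proof.
move=> ca c1 c2 c3 x.
have a1 := continuous_comp (c1 x) (ca (f1 x)).
have a2 := continuous_comp (c2 x) (ca (f2 x)).
have a3 := continuous_comp (c3 x) (ca (f3 x)).
have c23 := continuous_cross c2 c3 (x := x).
have c13 := continuous_cross c1 c3 (x := x).
have c12 := continuous_cross c1 c2 (x := x).
exact: (cvgD (cvgB (cvgM c23 a1) (cvgM c13 a2)) (cvgM c12 a3)).
Qed.

Lemma concurrency_segment (R : realType) (B : set 'rV[R]_2) alpha p q g1 g2 g3 h1 h2 h3 :
  continuous alpha ->
  hexagon_frame B p q g1 g2 g3 -> hexagon_frame B p q h1 h2 h3 ->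
  concurrency alpha g1 g2 g3 * concurrency alpha h1 h2 h3 <= 0 ->
  exists k1 k2 k3, hexagon_frame B p q k1 k2 k3 /\ concurrency alpha k1 k2 k3 = 0.
Proof.
move=> ca G H neg.
pose k (g h : 'rV[R]_2) (s : R) := g + s *: (h - g).
have ck g h : continuous (k g h).
  move=> s; have c1 : (fun=> g) @ s --> g by exact: cst_continuous.
  have c2 : id @ s --> s by exact: cvg_id.
  exact: (cvgD c1 (cvgZr_tmp (a := h - g) c2)).
pose F s := concurrency alpha (k g1 h1 s) (k g2 h2 s) (k g3 h3 s).
have cF : continuous F by exact: continuous_concurrency.
have k0 g h : k g h 0 = g by rewrite /k scale0r addr0.
have k1 g h : k g h 1 = h by rewrite /k scale1r addrC subrK.
have [|s s01 Fs] := @IVT R F 0 1 0 ler01 (continuous_subspaceT cF).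
  rewrite /F !k0 !k1 ge_min le_max; move: (concurrency _ _ _ _) neg => u.
  move: (concurrency _ _ _ _) => v uv; apply/andP; split; apply/orP.
    have [u0|u0] := leP u 0; [by left|right; rewrite leNgt; apply/negP => v0].
    by have := mulr_gt0 u0 v0; rewrite ltNge uv.
  have [u0|u0] := leP 0 u; [by left|right; rewrite leNgt; apply/negP => v0].
  by have := v0; rewrite -(nmulr_rgt0 _ u0) ltNge uv.
exists (k g1 h1 s), (k g2 h2 s), (k g3 h3 s); split=> //.
by apply: hexagon_frame_conv => //; move: s01; rewrite in_itv.
Qed.

(** If [y > 1] for [q' = x *: p + y *: q], the bound of [g2] at [q'] gives [x < 0], and then [g3] at
    [q' - p] is a convex combination of [1 - x] and [y], both above 1. Hence the positively oriented
    frames with a given [p] have their second vertices on a line parallel to [p]. *)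
Lemma hexagon_height_le (R : realType) (B : set 'rV[R]_2) p q q' g1 g2 g3 :
  abs_convex B -> hexagon_frame B p q g1 g2 g3 -> 0 < cross p q ->
  B q' -> B (q' - p) -> cross p q' <= cross p q.
Proof.
move=> cB H pq Bq' Br'.
have [_ /andP[b0 _] /andP[c0 c1]] := hexagon_frame_coef cB H.
case: H => Bp Bq Br G1 G2 G3 g1p g2q g3r.
have d0 : cross p q != 0 by exact: lt0r_neq0.
have E := cross_decomp q' d0.
move: E; set y := cross p q' / _; move: (cross q' q / _) => x E.
suff y1 : y <= 1 by move: y1; rewrite /y ler_pdivrMr// mul1r.
rewrite leNgt; apply/negP => y1.
have := G2 _ Bq'; rewrite E dot_comb g2q => h2.
have := G3 _ Br'; rewrite (_ : q' - p = (x - 1) *: p + y *: q); last first.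
  by rewrite E; apply: rV2P; rewrite !mxE; ring.
have g3q : dot g3 q = 1 + dot g3 p by rewrite -g3r /dot !mxE; ring.
rewrite dot_comb g3q => h3.
have x0 : x < 0 by rewrite ltNge; apply/negP => x0; have := mulr_ge0 x0 b0; lra.
have [z0 w0] : 1 < 1 - x /\ 1 < y by split; lra.
have c01 : 0 <= - dot g3 p <= 1 by rewrite c0.
have := convex_comb_gt c01 w0 z0; lra.
Qed.

(* If the second vertex moves from [q] to [q + x *: p], then the boundary contains the
   segment from [q - p] to [q + x *: p], whose functional is [g2 = h3]: it links
   the two frames by segments along which all constraints persist. *)
Lemma concurrency_fibre_right (R : realType) (B : set 'rV[R]_2) alpha p q x
    g1 g2 g3 h1 h2 h3 :
  abs_convex B -> continuous alpha -> 0 <= x ->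
  hexagon_frame B p q g1 g2 g3 -> hexagon_frame B p (q + x *: p) h1 h2 h3 ->
  concurrency alpha g1 g2 g3 * concurrency alpha h1 h2 h3 <= 0 ->
  exists r k1 k2 k3, hexagon_frame B p r k1 k2 k3 /\ concurrency alpha k1 k2 k3 = 0.
Proof.
move=> cB ca; rewrite le_eqVlt => /orP[/eqP <-|x0].
  rewrite scale0r addr0 => G H neg.
  have [k1 [k2 [k3 K]]] := concurrency_segment ca G H neg.
  by exists q, k1, k2, k3.
move=> G H neg.
have [_ /andP[b0 _] _] := hexagon_frame_coef cB G.
have [_ _ /andP[c0 _]] := hexagon_frame_coef cB H.
have d0 := hexagon_frame_cross cB G.
case: (G) => Bp Bq Br G1 G2 G3 g1p g2q g3r.
case: (H) => _ Bq' Br' H1 H2 H3 h1p h2q h3r.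
have dotE (g z : 'rV[R]_2) : dot g (z + x *: p) = dot g z + x * dot g p.
  by rewrite /dot !mxE; ring.
have g2p : dot g2 p = 0.
  have := G2 _ Bq'; rewrite dotE g2q => h.
  apply/eqP; rewrite eq_le b0 andbT leNgt; apply/negP => b1.
  by have := mulr_gt0 x0 b1; lra.
have h3p : dot h3 p = 0.
  have := H3 _ Br; rewrite dotBr; move: h3r; rewrite dotBr dotE => h h'.
  apply/eqP; rewrite eq_le -oppr_ge0 c0 /= leNgt; apply/negP => c1.
  have := mulr_gt0 x0 (_ : 0 < - dot h3 p); rewrite oppr_gt0 => /(_ c1); lra.
have h3E : h3 = g2.
  apply/eqP; rewrite -subr_eq0; apply/eqP/(dot_eq0 d0).
    transitivity (dot h3 p - dot g2 p); last by rewrite h3p g2p subrr.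
    by rewrite /dot !mxE; ring.
  transitivity (dot h3 q - dot g2 q); first by rewrite /dot !mxE; ring.
  by move: h3r; rewrite dotBr dotE h3p g2q; lra.
have A : hexagon_frame B p q h1 g2 g2.
  by split=> //; rewrite dotBr g2q g2p subr0.
have A' : hexagon_frame B p (q + x *: p) h1 g2 g2.
  by split=> //; rewrite ?dotBr dotE g2q g2p mulr0 addr0 ?subr0.
(* [concurrency] does not involve the vertices, so the frames [A] and [A'] give it the same value,
   whose sign tells whether the zero is sought at [q] or at [q + x *: p]. *)
have [a0|a0] := leP (concurrency alpha g1 g2 g3 * concurrency alpha h1 g2 g2) 0.
  have [k1 [k2 [k3 K]]] := concurrency_segment ca G A a0.
  by exists q, k1, k2, k3.
have neg' : concurrency alpha h1 g2 g2 * concurrency alpha h1 h2 h3 <= 0.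
  move: neg a0; move: (concurrency _ g1 _ _) (concurrency _ h1 g2 _) => u v.
  move: (concurrency _ _ _ _) => w uw uv; rewrite -(pmulr_rle0 _ uv).
  have -> : u * v * (v * w) = (u * w) * (v * v) by ring.
  by rewrite mulr_le0_ge0// sqr_ge0.
have [k1 [k2 [k3 K]]] := concurrency_segment ca A' H neg'.
by exists (q + x *: p), k1, k2, k3.
Qed.

Lemma concurrency_fibre (R : realType) (B : set 'rV[R]_2) alpha p q q'
    g1 g2 g3 h1 h2 h3 :
  abs_convex B -> continuous alpha -> 0 < cross p q -> 0 < cross p q' ->
  hexagon_frame B p q g1 g2 g3 -> hexagon_frame B p q' h1 h2 h3 ->
  concurrency alpha g1 g2 g3 * concurrency alpha h1 h2 h3 <= 0 ->
  exists r k1 k2 k3, hexagon_frame B p r k1 k2 k3 /\ concurrency alpha k1 k2 k3 = 0.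
Proof.
move=> cB ca pq pq' G H neg.
have e : cross p q' = cross p q.
  apply/eqP; rewrite eq_le; apply/andP; split.
    by apply: (hexagon_height_le cB G) => //; case: H.
  by apply: (hexagon_height_le cB H) => //; case: G.
have d0 : cross p q != 0 by exact: lt0r_neq0.
have E := cross_decomp q' d0.
move: E; rewrite e divff// scale1r addrC; move: (_ / _) => x E.
have [x0|x0] := leP 0 x.
  by apply: (concurrency_fibre_right cB ca x0 G _ neg); rewrite -E.
have Nx0 : 0 <= - x by lra.
have E' : q = q' + (- x) *: p by rewrite E scaleNr addrK.
rewrite E' in G; rewrite mulrC in neg.
exact: (concurrency_fibre_right cB ca Nx0 H G neg).
Qed.

(** Both vertices lie on the ray of [w], and the functional of each is at most 1 at the other. Thus
    [t] determines [p] in [frame_space]. *)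
Lemma hexagon_frame_vertex_unique (R : realType) (B : set 'rV[R]_2) w p q p' q'
    g1 g2 g3 h1 h2 h3 :
  w != 0 -> hexagon_frame B p q g1 g2 g3 -> hexagon_frame B p' q' h1 h2 h3 ->
  cross w p = 0 -> cross w p' = 0 -> 0 <= dot w p -> 0 <= dot w p' -> p' = p.
Proof.
move=> w0 [Bp _ _ G1 _ _ g1p _ _] [Bp' _ _ H1 _ _ h1p' _ _] wp wp' wp0 wp'0.
have N0 := dot_gt0 w0.
have dotZ (g z : 'rV[R]_2) k : dot g (k *: z) = k * dot g z by rewrite /dot !mxE; ring.
have l0 : 0 <= dot w p / dot w w by rewrite divr_ge0// ltW.
have l0' : 0 <= dot w p' / dot w w by rewrite divr_ge0// ltW.
have := G1 _ Bp'; have := H1 _ Bp; move: g1p h1p'.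
rewrite (cross_eq0_scale w0 wp) (cross_eq0_scale w0 wp').
move: (dot w p / _) l0 (dot w p' / _) l0'.
move=> l l0 l' l0'; rewrite !dotZ => e e' i i'; congr (_ *: w).
apply/eqP; rewrite eq_le; apply/andP; split.
  by have := ler_wpM2l l0 i'; rewrite mulrCA e !mulr1.
by have := ler_wpM2l l0' i; rewrite mulrCA e' !mulr1.
Qed.

Lemma continuous_fst_comp (T U W : topologicalType) (f : W -> T * U) :
  continuous f -> continuous (fun x => (f x).1).
Proof.
by move=> cf x; apply: (continuous_comp (cf x)); exact: cvg_fst.
Qed.

Lemma continuous_snd_comp (T U W : topologicalType) (f : W -> T * U) :
  continuous f -> continuous (fun x => (f x).2).
Proof.
by move=> cf x; apply: (continuous_comp (cf x)); exact: cvg_snd.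
Qed.

(* A path from [- b1] to [b1] avoiding 0. *)
Definition arc (R : realType) (b1 b2 : 'rV[R]_2) (t : R) : 'rV[R]_2 :=
  t *: b1 + (1 - t * t) *: b2.

Lemma continuous_arc (R : realType) (b1 b2 : 'rV[R]_2) : continuous (arc b1 b2).
Proof.
move=> t; have c1 : id @ t --> t by exact: cvg_id.
have c2 : (fun s : R => 1 - s * s) @ t --> 1 - t * t.
  have c0 : (fun _ : R => 1 : R) @ t --> (1 : R) by exact: cst_continuous.
  exact: (cvgB c0 (cvgM c1 c1)).
exact: (cvgD (cvgZr_tmp (a := b1) c1) (cvgZr_tmp (a := b2) c2)).
Qed.

Lemma arc_neq0 (R : realType) (b1 b2 : 'rV[R]_2) t : cross b1 b2 != 0 -> arc b1 b2 t != 0.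
Proof.
move=> b12; apply/eqP => e.
have : cross (arc b1 b2 t) b2 = t * cross b1 b2 by rewrite /cross !mxE; ring.
have : cross b1 (arc b1 b2 t) = (1 - t * t) * cross b1 b2 by rewrite /cross !mxE; ring.
have -> : cross b1 (arc b1 b2 t) = 0 by rewrite e /cross !mxE; ring.
have -> : cross (arc b1 b2 t) b2 = 0 by rewrite e /cross !mxE; ring.
move=> /esym/eqP; rewrite mulf_eq0 (negbTE b12) orbF => /eqP h.
move=> /esym/eqP; rewrite mulf_eq0 (negbTE b12) orbF => /eqP t0.
by move: h; rewrite t0 mul0r subr0 => /eqP; rewrite oner_eq0.
Qed.

Definition frame_data (R : realType) : topologicalType :=
  (R * 'rV[R]_2 * 'rV[R]_2 * 'rV[R]_2 * 'rV[R]_2 * 'rV[R]_2)%type.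

(* The tuples [(t, p, q, g1, g2, g3)] where [p] points in the direction [arc b1 b2 t]. *)
Definition frame_space (R : realType) (B : set 'rV[R]_2) b1 b2 : set (frame_data R) :=
  [set z | [/\ -1 <= z.1.1.1.1.1 <= 1,
    hexagon_frame B z.1.1.1.1.2 z.1.1.1.2 z.1.1.2 z.1.2 z.2,
    cross (arc b1 b2 z.1.1.1.1.1) z.1.1.1.1.2 = 0,
    0 <= dot (arc b1 b2 z.1.1.1.1.1) z.1.1.1.1.2 &
    0 <= cross z.1.1.1.1.2 z.1.1.1.2]].

Lemma frame_data_continuous (R : realType) :
  [/\ continuous (fun z : frame_data R => z.1.1.1.1.1),
      continuous (fun z : frame_data R => z.1.1.1.1.2) &
      continuous (fun z : frame_data R => z.1.1.1.2)] /\
  [/\ continuous (fun z : frame_data R => z.1.1.2),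
      continuous (fun z : frame_data R => z.1.2) &
      continuous (fun z : frame_data R => z.2)].
Proof.
have c0 : continuous (id : frame_data R -> _) by move=> z; exact: cvg_id.
have c1 := continuous_fst_comp c0.
have c2 := continuous_fst_comp c1.
have c3 := continuous_fst_comp c2.
have c4 := continuous_fst_comp c3.
have c5 := continuous_fst_comp c4.
have d1 := continuous_snd_comp c0.
have d2 := continuous_snd_comp c1.
have d3 := continuous_snd_comp c2.
have d4 := continuous_snd_comp c3.
have d5 := continuous_snd_comp c4.
by split.
Qed.

Lemma compact_frame_space (R : realType) (B : set 'rV[R]_2) b1 b2 :
  compact B -> abs_convex B -> B b1 -> B b2 -> cross b1 b2 != 0 ->
  compact (frame_space B b1 b2).
Proof.
move=> kB cB Bb1 Bb2 b12.
have kP := compact_polar cB Bb1 Bb2 b12.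
have kBox : compact (`[-1, 1]%classic `*` B `*` B `*` polar B `*` polar B
    `*` polar B : set (frame_data R)).
  by do 5 (apply: compact_setX => //); exact: segment_compact.
have [[ct cp cq] [cg1 cg2 cg3]] := frame_data_continuous R.
have cr : continuous (fun z : frame_data R => z.1.1.1.2 - z.1.1.1.1.2).
  by move=> z; exact: (cvgB (cq z) (cp z)).
have cw : continuous (fun z : frame_data R => arc b1 b2 z.1.1.1.1.1).
  by move=> z; exact: (continuous_comp (ct z) (@continuous_arc _ b1 b2 _)).
have cle (f : frame_data R -> R) : continuous f -> closed [set z | 0 <= f z].
  by move=> cf; exact: ((continuous_closedP _).1 cf _ (@closed_ge _ 0)).
have ceq (f : frame_data R -> R) k : continuous f -> closed [set z | f z = k].
  by move=> cf; exact: ((continuous_closedP _).1 cf _ (@closed_eq _ k)).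
pose C := [set z : frame_data R | B (z.1.1.1.2 - z.1.1.1.1.2)]
  `&` [set z | dot z.1.1.2 z.1.1.1.1.2 = 1]
  `&` [set z | dot z.1.2 z.1.1.1.2 = 1]
  `&` [set z | dot z.2 (z.1.1.1.2 - z.1.1.1.1.2) = 1]
  `&` [set z | cross (arc b1 b2 z.1.1.1.1.1) z.1.1.1.1.2 = 0]
  `&` [set z | 0 <= dot (arc b1 b2 z.1.1.1.1.1) z.1.1.1.1.2]
  `&` [set z | 0 <= cross z.1.1.1.1.2 z.1.1.1.2].
have clC : closed C.
  apply: closedI; last by apply: cle; exact: continuous_cross.
  apply: closedI; last by apply: cle; exact: continuous_dot.
  apply: closedI; last by apply: ceq; exact: continuous_cross.
  apply: closedI; last exact: (ceq _ 1 (continuous_dot cg3 cr)).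
  apply: closedI; last exact: (ceq _ 1 (continuous_dot cg2 cq)).
  apply: closedI; last exact: (ceq _ 1 (continuous_dot cg1 cp)).
  exact: ((continuous_closedP _).1 cr _ (compact_closed (@norm_hausdorff _ _) kB)).
suff -> : frame_space B b1 b2 = (`[-1, 1]%classic `*` B `*` B `*` polar B
    `*` polar B `*` polar B : set (frame_data R)) `&` C.
  exact: compact_closedI.
apply/seteqP; split; case=> [[[[[t p] q] g1] g2] g3] /=.
  case=> /= t1 [Bp Bq Br G1 G2 G3 g1p g2q g3r] wp wp0 pq.
  by do !split => //=; rewrite in_itv.
case=> [[[[[[/= t1 Bp] Bq] G1] G2] G3]] [[[[[[/= Br g1p] g2q] g3r] wp] wp0] pq].
by split => //; move: t1; rewrite in_itv.
Qed.

(** Negating a frame over [t = -1] gives one over [t = 1] with the opposite value of [concurrency],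
    as [alpha] is odd. So some fibre contains both signs; its frames share [p], and
    [concurrency_fibre] yields a zero. *)
Lemma concurrent_frame (R : realType) (B : set 'rV[R]_2) b1 b2 (alpha : 'rV[R]_2 -> R) :
  compact B -> abs_convex B -> B b1 -> B b2 -> cross b1 b2 != 0 ->
  continuous alpha -> (forall g, alpha (- g) = - alpha g) ->
  exists p q g1 g2 g3, hexagon_frame B p q g1 g2 g3 /\ concurrency alpha g1 g2 g3 = 0.
Proof.
move=> kB cB Bb1 Bb2 b12 ca odda.
have kX := compact_frame_space kB cB Bb1 Bb2 b12.
have [[ct cp cq] [cg1 cg2 cg3]] := frame_data_continuous R.
have cphi : continuous (fun z : frame_data R => concurrency alpha z.1.1.2 z.1.2 z.2).
  exact: continuous_concurrency.
have fX t : -1 <= t <= 1 -> exists2 z, frame_space B b1 b2 z & z.1.1.1.1.1 = t.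
  move=> t1; have w0 := arc_neq0 t b12.
  have [p [q [g1 [g2 [g3 [H wp wp0 pq]]]]]] := hexagon_frame_exists kB cB Bb1 Bb2 b12 w0.
  by exists (t, p, q, g1, g2, g3) => //; split=> //=; exact: ltW.
suff [x [y [Xx Xy xy nx py]]] : exists x y : frame_data R,
    [/\ frame_space B b1 b2 x, frame_space B b1 b2 y, x.1.1.1.1.1 = y.1.1.1.1.1,
      concurrency alpha x.1.1.2 x.1.2 x.2 <= 0 & 0 <= concurrency alpha y.1.1.2 y.1.2 y.2].
  move: Xx Xy xy nx py; case: x => [[[[[t p] q] g1] g2] g3]; case: y => [[[[[s p'] q'] h1] h2] h3].
  move=> /= [/= _ G wp wp0 pq] [/= _ H wp' wp'0 pq'] ts ng ph.
  rewrite -ts in wp' wp'0.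
  have e := hexagon_frame_vertex_unique (arc_neq0 t b12) G H wp wp' wp0 wp'0.
  rewrite e in H pq'.
  have [] := concurrency_fibre cB ca _ _ G H (mulr_le0_ge0 ng ph).
  (* Membership in [frame_space] gives only the closed condition [0 <= cross p q]; the frame
     excludes equality. *)
  - by rewrite lt_neqAle eq_sym (hexagon_frame_cross cB G).
  - by rewrite lt_neqAle eq_sym (hexagon_frame_cross cB H).
  by move=> r [k1 [k2 [k3 K]]]; exists p, r, k1, k2, k3.
have conN g1 g2 g3 : concurrency alpha (- g1) (- g2) (- g3) = - concurrency alpha g1 g2 g3.
  by rewrite /concurrency !odda /cross !mxE; ring.
have m1 : (-1 : R) <= 1 by lra.
have m11 : -1 <= (-1 : R) <= 1 by rewrite lexx.
have arcN : arc b1 b2 1 = - arc b1 b2 (-1).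
  by rewrite /arc; apply: rV2P; rewrite !mxE; ring.
have [[[[[[t p] q] g1] g2] g3] Xz /= tE] := fX (-1) m11.
have Xz' : frame_space B b1 b2 (1, - p, - q, - g1, - g2, - g3).
  case: Xz => /= _ [Bp Bq Br G1 G2 G3 g1p g2q g3r] wp wp0 pq.
  rewrite tE in wp wp0.
  have dotNN (g z : 'rV[R]_2) : dot (- g) (- z) = dot g z by rewrite /dot !mxE; ring.
  have crossNN (g z : 'rV[R]_2) : cross (- g) (- z) = cross g z by rewrite /cross !mxE; ring.
  split => /=; rewrite ?arcN ?dotNN ?crossNN//; first by rewrite m1 lexx.
  split; rewrite -?opprD ?dotNN//; try exact: polarN; exact: abs_convexN.
case: (leP (concurrency alpha g1 g2 g3) 0) => h.
  apply: (compact_fibre_ivt m1 kX ct cphi fX).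
    by exists (t, p, q, g1, g2, g3).
  by exists (1, - p, - q, - g1, - g2, - g3) => //=; rewrite conN oppr_ge0.
have cphiN : continuous (fun z : frame_data R => - concurrency alpha z.1.1.2 z.1.2 z.2).
  by move=> z; exact: (cvgN (cphi z)).
have [||x [y [Xx Xy xy nx py]]] := compact_fibre_ivt m1 kX ct cphiN fX.
- by exists (t, p, q, g1, g2, g3) => //=; rewrite oppr_le0 ltW.
- by exists (1, - p, - q, - g1, - g2, - g3) => //=; rewrite conN opprK ltW.
by exists y, x; split=> //; [rewrite -oppr_ge0|rewrite -oppr_le0].
Qed.

(** If [g1] and [g2] are independent, Cramer's rule gives [x] and the vanishing determinant gives
    the third equation. Otherwise [dot g1 q = dot g2 p = 1], which makes [g2] and [g3]
    independent. *)
Lemma concurrency_center (R : realType) (B : set 'rV[R]_2) (alpha : 'rV[R]_2 -> R) p q g1 g2 g3 :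
  abs_convex B -> hexagon_frame B p q g1 g2 g3 -> concurrency alpha g1 g2 g3 = 0 ->
  exists x, [/\ dot g1 x = alpha g1, dot g2 x = alpha g2 & dot g3 x = alpha g3].
Proof.
move=> cB H; have := hexagon_frame_coef cB H; have pq := hexagon_frame_cross cB H.
case: H => Bp Bq Br G1 G2 G3 g1p g2q g3r.
have g3q : dot g3 q = 1 + dot g3 p by rewrite -g3r /dot !mxE; ring.
move=> [/andP[a0 a1] /andP[b0 b1] /andP[c0 c1]].
have crossE (g h : 'rV[R]_2) :
    cross g h * cross p q = dot g p * dot h q - dot g q * dot h p.
  by rewrite /dot /cross; ring.
have solve (g h k : 'rV[R]_2) : cross g h != 0 ->
    cross h k * alpha g - cross g k * alpha h + cross g h * alpha k = 0 ->
    exists x, [/\ dot g x = alpha g, dot h x = alpha h & dot k x = alpha k].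
  move=> gh e.
  exists (\row_j if j == 0 then (alpha g * h 0 1 - alpha h * g 0 1) / cross g h
                 else (alpha h * g 0 0 - alpha g * h 0 0) / cross g h).
  have gh' : g 0 0 * h 0 1 - g 0 1 * h 0 0 != 0 by [].
  rewrite /dot !mxE /=; split.
  - by rewrite /cross; field.
  - by rewrite /cross; field.
  apply: (mulfI gh); rewrite (_ : cross g h * alpha k =
    - (cross h k * alpha g - cross g k * alpha h)); last by lra.
  by rewrite /cross; field.
have [g12|g12] := eqVneq (cross g1 g2) 0; last by move=> e; exact: solve.
have := crossE g1 g2; have := crossE g2 g3; rewrite g12 mul0r g1p g2q g3q => e23 e12.
have a1' : dot g1 q = 1 by nra.
have b1' : dot g2 p = 1 by nra.
have g23 : cross g2 g3 != 0.
  apply/eqP => h; move: e23; rewrite h mul0r b1'; lra.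
move=> e; have [|x [h2 h3 h1]] := solve g2 g3 g1 g23; last by exists x.
by rewrite -e /concurrency /cross; ring.
Qed.

(** * Three families of centres *)

(** The support function of the points [x0 :: l]; the separate head keeps the list non-empty. *)
Definition max_dot (R : realType) (x0 : 'rV[R]_2) (l : seq 'rV[R]_2) (g : 'rV[R]_2) : R :=
  foldr (fun x m => Num.max (dot g x) m) (dot g x0) l.

Lemma max_dot_ge (R : realType) (x0 : 'rV[R]_2) l g x :
  x \in x0 :: l -> dot g x <= max_dot x0 l g.
Proof.
elim: l => [|y l IH]; first by rewrite inE => /eqP ->.
rewrite !inE orbCA le_max => /orP[/eqP ->|h]; first by rewrite lexx.
by rewrite IH ?orbT// inE.
Qed.

Lemma max_dot_mem (R : realType) (x0 : 'rV[R]_2) l g :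
  exists2 x, x \in x0 :: l & dot g x = max_dot x0 l g.
Proof.
elim: l => [|y l [x xl e]]; first by exists x0; rewrite ?inE.
rewrite /= /Num.max; case: ltP => _; last by exists y; rewrite // !inE eqxx orbT.
by exists x => //; move: xl; rewrite !inE orbCA => ->; rewrite orbT.
Qed.

Lemma continuous_max_dot (R : realType) (x0 : 'rV[R]_2) l : continuous (max_dot x0 l).
Proof.
have cd (x : 'rV[R]_2) : continuous (fun g : 'rV[R]_2 => dot g x).
  apply: continuous_dot; last exact: cst_continuous.
  by move=> g; exact: cvg_id.
elim: l => [|y l IH]; first exact: cd.
by move=> g; apply: (continuous_max (cd y g) (IH g)).
Qed.

(** [- max_dot x0 l (- g)] is the minimum of [dot g], so this is the midpoint of its range. *)
Definition mid_dot (R : realType) (x0 : 'rV[R]_2) l (g : 'rV[R]_2) : R :=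
  (max_dot x0 l g - max_dot x0 l (- g)) / 2.

Lemma mid_dotN (R : realType) (x0 : 'rV[R]_2) l g : mid_dot x0 l (- g) = - mid_dot x0 l g.
Proof. by rewrite /mid_dot opprK -mulNr opprB. Qed.

Lemma continuous_mid_dot (R : realType) (x0 : 'rV[R]_2) l : continuous (mid_dot x0 l).
Proof.
move=> g; have c1 := @continuous_max_dot _ x0 l g.
have cN : (fun h : 'rV[R]_2 => - h) @ g --> - g by exact: (cvgN cvg_id).
have c2 := continuous_comp cN (@continuous_max_dot _ x0 l (- g)).
have c3 : (fun=> 2^-1 : R) @ g --> (2^-1 : R) by exact: cst_continuous.
exact: (cvgM (cvgB c1 c2) c3).
Qed.

Lemma mid_dot_extremes (R : realType) (x0 : 'rV[R]_2) l g :
  exists h x y, [/\ x \in x0 :: l, y \in x0 :: l, dot g x = mid_dot x0 l g + h,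
    dot g y = mid_dot x0 l g - h &
    forall z, z \in x0 :: l -> `|dot g z - mid_dot x0 l g| <= h].
Proof.
have [x xl ex] := max_dot_mem x0 l g; have [y yl ey] := max_dot_mem x0 l (- g).
exists ((max_dot x0 l g + max_dot x0 l (- g)) / 2), x, y; rewrite /mid_dot; split=> //.
- by rewrite ex; field.
- by rewrite -[LHS]opprK -dotN ey; field.
move=> z zl; have := max_dot_ge g zl; have := max_dot_ge (- g) zl.
by rewrite dotN ler_norml => ? ?; apply/andP; split; lra.
Qed.

(* If the union is wider than [B] in the direction [g], one family [m] alone is
   responsible; [e = 0] otherwise. *)
Definition excess (R : realType) (A : 'I_3 -> seq 'rV[R]_2) (alpha : 'rV[R]_2 -> R)
    (g : 'rV[R]_2) (e : R) (m : 'I_3) : Prop :=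
  [/\ 0 <= e, forall i x, x \in A i -> `|dot g x - alpha g| <= 1 + e &
    forall i x, i != m -> x \in A i -> `|dot g x - alpha g| <= 1 - e].

Lemma excessN (R : realType) (A : 'I_3 -> seq 'rV[R]_2) (alpha : 'rV[R]_2 -> R) g e m :
  (forall h, alpha (- h) = - alpha h) -> excess A alpha g e m -> excess A alpha (- g) e m.
Proof.
move=> odda [e0 h1 h2]; split=> // i x.
  by move=> xi; rewrite odda dotN -opprD normrN; exact: h1 xi.
by move=> im xi; rewrite odda dotN -opprD normrN; exact: h2 im xi.
Qed.

Definition cross_close (R : realType) (B : set 'rV[R]_2) (A : 'I_3 -> seq 'rV[R]_2) : Prop :=
  forall i j x y, i != j -> x \in A i -> y \in A j -> B (2^-1 *: (x - y)).

(** Let [h] be half the width of the union. If [h > 1], the extreme points are more than 2 apart, so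
    they share a family; values on the other families are within 2 of both ends, hence within
    [2 - h = 1 - e] of the midpoint for [e = h - 1]. *)
Lemma excess_exists (R : realType) (B : set 'rV[R]_2) (A : 'I_3 -> seq 'rV[R]_2) x0 l g :
  cross_close B A -> polar B g ->
  (forall x, x \in x0 :: l <-> exists i, x \in A i) ->
  exists e m, excess A (mid_dot x0 l) g e m.
Proof.
move=> cA Pg lA; have [h [x [y [xl yl ex ey hl]]]] := mid_dot_extremes x0 l g.
have cross_le i j z w : i != j -> z \in A i -> w \in A j -> dot g z - dot g w <= 2.
  move=> ij zi wj; have := Pg _ (cA _ _ _ _ ij zi wj).
  rewrite (_ : dot g _ = (dot g z - dot g w) / 2); first by lra.
  by rewrite /dot !mxE; field.
have [h1|h1] := leP h 1.
  exists 0, ord0; split=> // i z.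
    by move=> zi; rewrite addr0; apply: le_trans h1; apply/hl/lA; exists i.
  by move=> _ zi; rewrite subr0; apply: le_trans h1; apply/hl/lA; exists i.
have [i xi] := (lA x).1 xl; have [j yj] := (lA y).1 yl.
have [ij|ij] := eqVneq i j; last by have := cross_le _ _ _ _ ij xi yj; lra.
exists (h - 1), i; split; first by lra.
  move=> k z zk; have -> : 1 + (h - 1) = h by ring.
  by apply/hl/lA; exists k.
move=> k z ki zk; rewrite ler_norml; apply/andP; split.
  by rewrite eq_sym in ki; have := cross_le _ _ _ _ ki xi zk; lra.
by rewrite ij in ki; have := cross_le _ _ _ _ ki zk yj; lra.
Qed.

Definition three_pierced (R : realType) (B : set 'rV[R]_2) (l : seq 'rV[R]_2) : Prop :=
  exists z1 z2 z3, forall x, x \in l -> [\/ B (x - z1), B (x - z2) | B (x - z3)].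

Lemma frame_three_pierced (R : realType) (B : set 'rV[R]_2) (l : seq 'rV[R]_2)
    p q g1 g2 g3 c e :
  abs_convex B -> hexagon_frame B p q g1 g2 g3 -> 0 <= e ->
  (forall x, x \in l -> [/\ `|dot g1 x - dot g1 c| <= 1 + e,
    `|dot g2 x - dot g2 c| <= 1 - e & `|dot g3 x - dot g3 c| <= 1 - e]) ->
  three_pierced B l.
Proof.
move=> cB H e0 hl; have [z1 [z2 [z3 hz]]] := hexagon_frame_cover cB H e0.
exists (c + z1), (c + z2), (c + z3) => x /hl[h1 h2 h3].
by rewrite !opprD !addrA; apply: hz; rewrite dotBr.
Qed.

Lemma ord3_avoid (a b : 'I_3) : exists m : 'I_3, (m != a) && (m != b).
Proof.
have : (0 < #|[predC pred2 a b]|)%N.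
  by have := cardC (pred2 a b); rewrite card_ord card2; case: #|_| => //; case: (a != b).
by case/card_gt0P => m; rewrite !inE negb_or => h; exists m.
Qed.

(** If [m1] differs from [m2] and [m3], the family [m1] is narrow for [g2] and [g3], with margins at
    least [e1]. Otherwise at most two indices occur, and a family avoiding them lies in all three
    strips of half-width 1, the case [e = 0] of the cover. *)
Lemma concurrent_three_pierced (R : realType) (B : set 'rV[R]_2)
    (A : 'I_3 -> seq 'rV[R]_2) (alpha : 'rV[R]_2 -> R) p q g1 g2 g3 c
    e1 m1 e2 m2 e3 m3 :
  abs_convex B -> hexagon_frame B p q g1 g2 g3 ->
  dot g1 c = alpha g1 -> dot g2 c = alpha g2 -> dot g3 c = alpha g3 ->
  excess A alpha g1 e1 m1 -> excess A alpha g2 e2 m2 -> excess A alpha g3 e3 m3 ->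
  e1 <= e2 -> e1 <= e3 -> exists m, three_pierced B (A m).
Proof.
move=> cB H c1 c2 c3 [e10 w1 n1] [e20 w2 n2] [e30 w3 n3] e12 e13.
have avoid m : m != m1 -> m != m2 -> m != m3 -> three_pierced B (A m).
  move=> k1 k2 k3; apply: (frame_three_pierced cB H (lexx 0) (c := c)) => x xm.
  rewrite c1 c2 c3 addr0 subr0; split.
  - by have := n1 _ _ k1 xm; lra.
  - by have := n2 _ _ k2 xm; lra.
  - by have := n3 _ _ k3 xm; lra.
have [m12|m12] := eqVneq m1 m2.
  have [m /andP[k1 k3]] := ord3_avoid m1 m3.
  by exists m; apply: avoid; rewrite // -m12.
have [m13|m13] := eqVneq m1 m3.
  have [m /andP[k1 k2]] := ord3_avoid m1 m2.
  by exists m; apply: avoid; rewrite // -m13.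
exists m1; apply: (frame_three_pierced cB H e10 (c := c)) => x xm.
rewrite c1 c2 c3; split.
- exact: w1 xm.
- by have := n2 _ _ m12 xm; lra.
- by have := n3 _ _ m13 xm; lra.
Qed.

Lemma enum_union (T : eqType) (A : 'I_3 -> seq T) i x : x \in A i ->
  exists x0 l, forall y, y \in x0 :: l <-> exists j, y \in A j.
Proof.
move=> xi; exists x, (flatten [seq A j | j <- enum 'I_3]) => y; split.
  rewrite inE => /orP[/eqP ->|/flatten_mapP[j _ yj]]; first by exists i.
  by exists j.
move=> [j yj]; rewrite inE; apply/orP; right.
by apply/flatten_mapP; exists j; rewrite // mem_enum.
Qed.

Lemma planar_three_pierced (R : realType) (B : set 'rV[R]_2)
    (A : 'I_3 -> seq 'rV[R]_2) b1 b2 :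
  compact B -> abs_convex B -> B b1 -> B b2 -> cross b1 b2 != 0 ->
  (exists x, x \in A ord0) -> cross_close B A -> exists m, three_pierced B (A m).
Proof.
move=> kB cB Bb1 Bb2 b12 [x x0] cA.
have {x x0} [x0 [l lA]] := enum_union x0.
pose alpha := mid_dot x0 l.
have odda g : alpha (- g) = - alpha g by exact: mid_dotN.
have [p [q [g1 [g2 [g3 [H con]]]]]] :=
  concurrent_frame kB cB Bb1 Bb2 b12 (@continuous_mid_dot _ x0 l) odda.
have [c [c1 c2 c3]] := concurrency_center cB H con.
have [e1 [m1 E1]] := excess_exists cA (frame_g1 H) lA.
have [e2 [m2 E2]] := excess_exists cA (frame_g2 H) lA.
have [e3 [m3 E3]] := excess_exists cA (frame_g3 H) lA.
(* Rotating the frame puts the functional of least excess first; the signs are absorbed because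
   [alpha] is odd. *)
have H' := hexagon_frame_rot cB H; have H'' := hexagon_frame_rot cB H'.
have c1N : dot (- g1) c = alpha (- g1) by rewrite dotN odda c1.
have c2N : dot (- g2) c = alpha (- g2) by rewrite dotN odda c2.
have [e12|e12] := leP e1 e2.
  have [e13|e13] := leP e1 e3.
    exact: (concurrent_three_pierced cB H c1 c2 c3 E1 E2 E3 e12 e13).
  exact: (concurrent_three_pierced cB H'' c3 c1N c2N E3 (excessN odda E1)
    (excessN odda E2) (ltW e13) (le_trans (ltW e13) e12)).
have [e23|e23] := leP e2 e3.
  exact: (concurrent_three_pierced cB H' c2 c3 c1N E2 E3 (excessN odda E1) e23 (ltW e12)).
exact: (concurrent_three_pierced cB H'' c3 c1N c2N E3 (excessN odda E1)
  (excessN odda E2) (ltW (lt_trans e23 e12)) (ltW e23)).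
Qed.

(** [B] is the segment from [- v] to [v], with [v] a longest vector, and all centres lie in [x0]
    plus the multiples of [v]. A family other than [m] stays within [1 - e] of the midpoint, so a
    single translate covers it. *)
Lemma collinear_three_pierced (R : realType) (B : set 'rV[R]_2)
    (A : 'I_3 -> seq 'rV[R]_2) :
  compact B -> abs_convex B -> B 0 ->
  (forall b1 b2, B b1 -> B b2 -> cross b1 b2 = 0) ->
  (forall i, exists x, x \in A i) -> cross_close B A ->
  exists m, three_pierced B (A m).
Proof.
move=> kB cB B0 colB A0 cA.
have [v Bv vmax] : exists2 v, B v & forall b, B b -> dot b b <= dot v v.
  have [|||v /set_mem Bv vmax] := @compact_EVT_max _ R (fun b : 'rV[R]_2 => dot b b) B => //.
  - by exists 0.
  - apply: continuous_subspaceT; have ci : continuous (id : 'rV[R]_2 -> _).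
      by move=> b; exact: cvg_id.
    exact: (continuous_dot ci ci).
  - by exists v => // b Bb; apply: vmax; rewrite inE.
have Bs b : B b -> exists2 s, `|s| <= 1 & b = s *: v.
  move=> Bb; have [v0|v0] := eqVneq v 0.
    exists 0; rewrite ?normr0// scale0r; apply/eqP.
    apply: contraT => /dot_gt0; rewrite ltNge; have := vmax _ Bb.
    by rewrite v0 [X in _ <= X](_ : _ = 0) => [->|]; rewrite // /dot !mxE mulr0 addr0.
  have N0 := dot_gt0 v0; have e := cross_eq0_scale v0 (colB _ _ Bv Bb).
  exists (dot v b / dot v v) => //; move: e; set s := _ / _ => e.
  have := vmax _ Bb; rewrite e (_ : dot _ _ = `|s| ^+ 2 * dot v v); last first.
    by rewrite real_normK ?num_real// /dot !mxE; ring.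
  by rewrite ger_pMl// expr_le1.
have [x0 x00] := A0 ord0; have [y1 y11] := A0 1.
have line i x : x \in A i -> exists t, x = x0 + t *: v.
  have far j y : j != ord0 -> y \in A j -> exists t, y = x0 + t *: v.
    move=> j0 yj; have [s _ e] := Bs _ (cA _ _ _ _ j0 yj x00).
    exists (2 * s); rewrite -scalerA -e scalerA divff ?scale1r ?pnatr_eq0//.
    by rewrite addrC subrK.
  have [->|i0] := eqVneq i ord0; last exact: far.
  (* Points of family 0 are compared with [y1], because [cross_close] relates different families
     only. *)
  move=> xi; have [t ty] := far 1 y1 isT y11.
  have [s _ e] := Bs _ (cA ord0 1 _ _ isT xi y11).
  exists (t + 2 * s); rewrite scalerDl addrA -ty -scalerA -e scalerA divff ?scale1r ?pnatr_eq0//.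
  by rewrite addrC subrK.
have [v0|v0] := eqVneq v 0.
  exists ord0, x0, x0, x0 => x /line[t ->]; apply: Or31.
  by rewrite v0 scaler0 addr0 subrr.
have N0 := dot_gt0 v0; pose g := (dot v v)^-1 *: v.
have gv : dot g v = 1.
  transitivity ((dot v v)^-1 * dot v v); last by rewrite mulVf ?lt0r_neq0.
  by rewrite /g /dot !mxE; ring.
have dotE (z : 'rV[R]_2) t : dot g (z + t *: v) = dot g z + t.
  by rewrite -[X in _ = _ + X]mulr1 -gv /dot !mxE; ring.
have Pg : polar B g.
  move=> b /Bs[s s1 ->]; rewrite -[s *: v]add0r dotE.
  rewrite (_ : dot g 0 = 0); first by rewrite add0r (le_trans (ler_norm s)).
  by rewrite /dot !mxE !mulr0 addr0.
have [x [l lA]] := enum_union x00.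
have [e [m [e0 _ narrow]]] := excess_exists cA Pg lA.
have [i /andP[im _]] := ord3_avoid m m.
pose c := x0 + (mid_dot x l g - dot g x0) *: v.
exists i, c, c, c => z zi; apply: Or31.
have [t zt] := line _ _ zi; have := narrow _ _ im zi.
rewrite zt dotE => h; rewrite (_ : _ - c = (dot g x0 + t - mid_dot x l g) *: v).
  by apply: abs_convexZ => //; apply: le_trans h _; lra.
by apply: rV2P; rewrite !mxE; ring.
Qed.

(** * From translates of [K] to translation vectors *)

Lemma convex_sym_abs_convex (R : realType) (B : set 'rV[R]_2) :
  convex_set B -> (forall x, B x -> B (- x)) -> B 0 -> abs_convex B.
Proof.
move=> convB symB B0 x y s t Bx By st.
have conv2 (u v : 'rV[R]_2) (k : R) : 0 <= k <= 1 -> B u -> B v ->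
    B (k *: u + (1 - k) *: v).
  move=> k01 Bu Bv.
  have := convB u v (Itv01 (andP k01).1 (andP k01).2).
  by rewrite !inE => /(_ Bu Bv).
have Bsg (k : R) z : B z -> exists2 z', B z' & k *: z = `|k| *: z'.
  move=> Bz; have [k0|k0] := leP 0 k; first by exists z; rewrite // ger0_norm.
  by exists (- z); [exact: symB|rewrite ltr0_norm// scalerN scaleNr opprK].
have [x' Bx' ->] := Bsg s _ Bx; have [y' By' ->] := Bsg t _ By.
have s0 := normr_ge0 s; have t0 := normr_ge0 t.
have [n nE] : exists n, n = `|s| + `|t| by exists (`|s| + `|t|).
rewrite -nE in st; have n0 : 0 <= n by rewrite nE addr_ge0.
have [e|n1] := eqVneq n 0.
  have [-> ->] : `|s| = 0 /\ `|t| = 0 by rewrite nE in e; split; lra.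
  by rewrite !scale0r addr0.
have -> : `|s| *: x' + `|t| *: y' =
    n *: ((`|s| / n) *: x' + (1 - `|s| / n) *: y') + (1 - n) *: 0.
  by rewrite nE in n1 *; apply: rV2P; rewrite !mxE; field.
apply: (conv2) => //; first by rewrite n0.
have np : 0 < n by rewrite lt_neqAle eq_sym n1.
by apply: conv2 => //; rewrite divr_ge0//= ler_pdivrMr// mul1r; lra.
Qed.

(** [l] may repeat entries, so the exact cardinality [n] of its set of points is only bounded by its
    length; the least piercing cardinality is then at most [n]. *)
Lemma piercing_number_le (T : eqType) (F : set (set T)) (l : seq T) :
  l != [::] -> (forall A, F A -> exists2 x, x \in l & A x) ->
  exists2 k, is_piercing_number F k & (k <= size l)%N.
Proof.
case: l => // x0 l _ hl.
have /finite_setP[n ln] : finite_set [set` x0 :: l] by exact: finite_seq.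
have n0 : (0 < n)%N.
  rewrite lt0n; apply/eqP => e; rewrite e II0 in ln.
  move: ln; rewrite card_eq0 => /eqP/seteqP[/(_ x0) + _]; apply.
  by rewrite /= inE eqxx.
have nl : (n <= size (x0 :: l))%N.
  rewrite -card_le_II.
  rewrite -(card_le_eql ln); apply: card_le_trans (card_image_le (nth x0 (x0 :: l)) _).
  apply: subset_card_le => z zl; exists (index z (x0 :: l)); last exact: nth_index.
  by have : (index z (x0 :: l) < size (x0 :: l))%N by rewrite index_mem.
pose Q k := `[< (0 < k)%N /\ pierced_by F k >].
have Qn : Q n.
  apply/asboolP; split=> //; exists [set` x0 :: l] => // A /hl[x xl Ax].
  by exists x.
have exQ : exists k, Q k by exists n.
case: (ex_minnP exQ) => k /asboolP[k0 pk] kmin.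
exists k; last exact: leq_trans (kmin _ Qn) nl.
by split=> // j j0 pj; apply/kmin/asboolP.
Qed.

Theorem theorem1p2 (R : realType) (K : set 'rV[R]_2)
    (F : 'I_3 -> set (set 'rV[R]_2))
    (symK : centrally_symmetric K) (compactK : compact K)
    (convexK : convex_set K)
    (F_neq0 : forall i, F i !=set0) (F_finite : forall i, finite_set (F i))
    (F_translates : forall i A, F i A -> exists t, A = translate K t)
    (F_cross : forall i j A B,
       i != j -> F i A -> F j B -> A `&` B !=set0) :
  exists m : 'I_3, exists2 k : nat, is_piercing_number (F m) k & (k <= 3)%N.
Proof.
have [c symc] := symK.
have symP a : K a -> K (c *+ 2 - a) by move=> Ka; rewrite symc; exists a.
pose B := [set b | K (b + c)].
have symB b : B b -> B (- b).
  by move=> /symP; rewrite /B /= mulr2n opprD addrA addrAC addrK addrC.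
have compactB : compact B.
  have -> : B = (fun x => x - c) @` K.
    apply/seteqP; split=> [b Bb|_ [a Ka <-]]; last by rewrite /B /= subrK.
    by exists (b + c); rewrite ?addrK.
  apply: continuous_compact => //; apply: continuous_subspaceT => x.
  exact: (cvgB cvg_id (cvg_cst c)).
have convB : convex_set B.
  move=> x y k; rewrite !inE => Bx By.
  have := convexK (x + c) (y + c) k; rewrite !inE => /(_ Bx By).
  have e : k%:num *: x + (1 - k%:num) *: y + c =
      k%:num *: (x + c) + (1 - k%:num) *: (y + c).
    by apply: rV2P; rewrite !mxE; ring.
  by rewrite -[X in K X]/(k%:num *: (x + c) + (1 - k%:num) *: (y + c)) -e.
have mid b b' : B b -> B b' -> B (2^-1 *: b + (1 - 2^-1) *: b').
  have h : 0 <= (2^-1 : R) <= 1 by apply/andP; split; lra.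
  move=> Bb Bb'; have := convB b b' (Itv01 (andP h).1 (andP h).2).
  by rewrite !inE => /(_ Bb Bb').
(* [K] is non-empty because two of its translates meet, and 0 is the midpoint of a point of [B] and
   its opposite. *)
have [A0 FA0] := F_neq0 ord0; have [A1 FA1] := F_neq0 1.
have [a [A0a _]] := F_cross ord0 1 _ _ isT FA0 FA1.
have B0 : B 0.
  have [t At] := F_translates _ _ FA0; move: A0a; rewrite At => -[k Kk _].
  have Bk : B (k - c) by rewrite /B /= subrK.
  have := mid _ _ Bk (symB _ Bk); congr (B _).
  by apply: rV2P; rewrite !mxE; field.
have cB := convex_sym_abs_convex convB symB B0.
have cen i : exists l : seq 'rV[R]_2, (forall x, x \in l -> F i (translate K x)) /\
    (forall A, F i A -> exists2 x, x \in l & A = translate K x).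
  (* [ctr] picks one translation vector per translate; for members of [F i] there is one, so the
     default 0 is harmless. *)
  pose ctr A := xget 0 [set t | A = translate K t].
  have ctrP A : F i A -> A = translate K (ctr A).
    by move=> /F_translates[t At]; apply: (xgetPex 0 (P := [set t | A = translate K t])); exists t.
  have /finite_seqP[l lE] : finite_set (ctr @` F i) by exact: finite_image.
  exists l; split=> [x xl|A FA].
    have : [set` l] x by [].
    by rewrite -lE => -[A FA <-]; rewrite -(ctrP _ FA).
  exists (ctr A); last exact: ctrP.
  have : (ctr @` F i) (ctr A) by exists A.
  by rewrite lE.
have [A Acen] := choice cen.
have cA : cross_close B A.
  move=> i j x y ij xi yj.
  have [z [[k Kk kz] [h Kh hz]]] := F_cross _ _ _ _ ij ((Acen i).1 x xi) ((Acen j).1 y yj).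
  have Bh : B (h - c) by rewrite /B /= subrK.
  have Bk : B (k - c) by rewrite /B /= subrK.
  (* The common point is [k + x = h + y], so half of [x - y] is the midpoint of [h - c] and
     [- (k - c)]. *)
  have := mid _ _ Bh (symB _ Bk); congr (B _).
  have -> : x = z - k by rewrite -kz addrC addKr.
  have -> : y = z - h by rewrite -hz addrC addKr.
  by apply: rV2P; rewrite !mxE; field.
have Aneq0 i : exists x, x \in A i.
  by have [S FS] := F_neq0 i; have [x xi _] := (Acen i).2 _ FS; exists x.
have [m [z1 [z2 [z3 hz]]]] : exists m, three_pierced B (A m).
  have [[b1 [b2 [Bb1 Bb2 b12]]]|col] :=
      pselect (exists b1 b2, [/\ B b1, B b2 & cross b1 b2 != 0]).
    exact: (planar_three_pierced compactB cB Bb1 Bb2 b12 (Aneq0 ord0) cA).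
  apply: collinear_three_pierced => // b1 b2 Bb1 Bb2; apply/eqP.
  by apply: contrapT => /negP b12; apply: col; exists b1, b2.
exists m.
apply: (@piercing_number_le _ (F m) [:: z1 + c; z2 + c; z3 + c]) => // S FS.
have [x xm ->] := (Acen m).2 _ FS.
(* By symmetry [z - x] is in [B], so [z + c] is in [K + x]. *)
have hit z : B (x - z) -> translate K x (z + c).
  move=> /symB Bz; exists (- (x - z) + c) => //.
  by rewrite opprB addrAC subrK.
by have [/hit h|/hit h|/hit h] := hz _ xm; [exists (z1 + c)|exists (z2 + c)|exists (z3 + c)];
  rewrite // !inE eqxx ?orbT.
Qed.
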